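(* Let $N\ge3$, let $\varepsilon_1,\varepsilon_2,c\in\mathbb{C}$, $\hbar=\varepsilon_1+\varepsilon_2$, and assume $\hbar c=N\varepsilon_2$ and $\varepsilon_2\ne0$. Let $M$ be an irreducible $\hat{\mathfrak{gl}}_N$-module on which the central element acts by the scalar $c$ and on which the action of $U(\hat{\mathfrak{gl}}_N)$ extends to $U(\hat{\mathfrak{gl}}_N)_{\mathrm{comp},-}$ (so that the pull-back by $\mathrm{ev}$ is defined). Then the pull-back of $M$ by the evaluation map $\mathrm{ev}\colon Y(\hat{\mathfrak{sl}}_N)\to U(\hat{\mathfrak{gl}}_N)_{\mathrm{comp},-}$ is irreducible as a $Y(\hat{\mathfrak{sl}}_N)$-module.
   Context: Affine Yangian. Fix $N\ge3$. $Y(\hat{\mathfrak{sl}}_N)$ is the $\mathbb{C}$-algebra generated by $x_{i,r}^{+},x_{i,r}^-,h_{i,r}$ ($i\in\mathbb{Z}/N\mathbb{Z}$, $r\in\mathbb{Z}_{\ge0}$) with parameters $\varepsilon_1,\varepsilon_2\in\mathbb{C}$ and relations $[h_{i,r},h_{j,s}]=0$, $[x_{i,r}^+,x_{j,s}^-]=\delta_{ij}h_{i,r+s}$, $[h_{i,0},x_{j,r}^\pm]=\pm a_{ij}x_{j,r}^\pm$, $[h_{i,r+1},x_{j,s}^\pm]-[h_{i,r},x_{j,s+1}^\pm]=\pm a_{ij}\frac{\varepsilon_1+\varepsilon_2}{2}\{h_{i,r},x_{j,s}^\pm\}-m_{ij}\frac{\varepsilon_1-\varepsilon_2}{2}[h_{i,r},x_{j,s}^\pm]$,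 $[x_{i,r+1}^\pm,x_{j,s}^\pm]-[x_{i,r}^\pm,x_{j,s+1}^\pm]=\pm a_{ij}\frac{\varepsilon_1+\varepsilon_2}{2}\{x_{i,r}^\pm,x_{j,s}^\pm\}-m_{ij}\frac{\varepsilon_1-\varepsilon_2}{2}[x_{i,r}^\pm,x_{j,s}^\pm]$, $\sum_{w\in\mathfrak{S}_{1-a_{ij}}}[x_{i,r_{w(1)}}^\pm,[x_{i,r_{w(2)}}^\pm,\dots,[x_{i,r_{w(1-a_{ij})}}^\pm,x_{j,s}^\pm]\dots]]=0$ for $i\ne j$. Here $\{x,y\}=xy+yx$; $a_{ij}=2$ if $i=j$, $-1$ if $i=j\pm1$, $0$ otherwise; $m_{ij}=1$ if $j=i-1$, $-1$ if $j=i+1$, $0$ otherwise. Put $\hbar=\varepsilon_1+\varepsilon_2$, $x_i^\pm=x_{i,0}^\pm$, $h_i=h_{i,0}$. Affine Lie algebra. $\hat{\mathfrak{gl}}_N=\mathfrak{gl}_N\otimes\mathbb{C}[t,t^{-1}]\oplus\mathbb{C}c$ with $[X(r),Y(s)]=[X,Y](r+s)+r\delta_{r+s,0}\mathrm{tr}(XY)c$, $c$ central, $X(s)=X\otimes t^s$, $X=X(0)$. $E_{i,j}$ are matrix units. Put $x_0^+=E_{N,1}(1)$, $x_0^-=E_{1,N}(-1)$, $h_0=E_{N,N}-E_{1,1}+c$, and for $1\le i\le N-1$: $x_i^+=E_{i,i+1}$, $x_i^-=E_{i+1,i}$, $h_i=E_{i,i}-E_{i+1,i+1}$. The central element $c$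 is regarded as a complex number, i.e. $U(\hat{\mathfrak{gl}}_N)$ is taken with the central element specialized to the scalar $c$. Completion and evaluation map. Grade $U(\hat{\mathfrak{gl}}_N)=\bigoplus_d U[d]$ by $\deg X(s)=s$, $\deg c=0$, and let $U(\hat{\mathfrak{gl}}_N)_{\mathrm{comp},-}=\bigoplus_{d\in\mathbb{Z}}\varprojlim_n U[d]/\sum_{r>n}U[d+r]U[-r]$. Assuming $\hbar c=N\varepsilon_2$, it is known that there is a unique algebra homomorphism $\mathrm{ev}\colon Y(\hat{\mathfrak{sl}}_N)\to U(\hat{\mathfrak{gl}}_N)_{\mathrm{comp},-}$ with $\mathrm{ev}(x_i^\pm)=x_i^\pm$, $\mathrm{ev}(h_i)=h_i$, $\mathrm{ev}(x_{0,1}^+)=(1+N\varepsilon_2)x_0^++\hbar\sum_{s\ge0}\sum_{k=1}^N E_{k,1}(s+1)E_{N,k}(-s)$, $\mathrm{ev}(x_{0,1}^-)=(1+N\varepsilon_2)x_0^-+\hbar\sum_{s\ge0}\sum_{k=1}^N E_{k,N}(s)E_{1,k}(-s-1)$, and for $1\le i\le N-1$ $\mathrm{ev}(x_{i,1}^+)=(1+i\varepsilon_2)x_i^++\hbar\sum_{s\ge0}\big(\sum_{k=1}^iE_{k,i+1}(s)E_{i,k}(-s)+\sum_{k=i+1}^NE_{k,i+1}(s+1)E_{i,k}(-s-1)\big)$, $\mathrm{ev}(x_{i,1}^-)=(1+i\varepsilon_2)x_i^-+\hbar\sum_{s\ge0}\big(\sum_{k=1}^iE_{k,i}(s)E_{i+1,k}(-s)+\sum_{k=i+1}^NE_{k,i}(s+1)E_{i+1,k}(-s-1)\big)$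 (indices of $E$ read modulo $N$). *)

(* Defs.v *)
From HB Require Import structures.
From mathcomp Require Import finmap monalg.
From mathcomp Require Import all_boot all_order all_algebra perm complex.
From mathcomp Require Import boolp reals zify.

Set Implicit Arguments.
Unset Strict Implicit.
Unset Printing Implicit Defensive.

Import GRing.Theory Num.Theory.

Local Open Scope ring_scope.
Local Open Scope quotient_scope.

(* MathComp's algType requires 1 != 0, which is not known a priori for an    *)
(* algebra given by generators and relations.  Here a K-algebra is a ring,   *)
(* possibly zero, with a central ring morphism acst : K -> A, and the        *)
(* scaling of x by a is acst a * x, written a *s x.                          *)

HB.mixin Record isAssocAlgebra (K : fieldType) A of GRing.PzRing A := {
  acst : K -> A;
  acst1 : acst 1 = 1;
  acstD : {morph acst : a b / a + b};
  acstM : {morph acst : a b / a * b};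
  acstC : forall (a : K) (x : A), acst a * x = x * acst a
}.

#[short(type="assocAlgType")]
HB.structure Definition AssocAlgebra (K : fieldType) :=
  {A of GRing.PzRing A & isAssocAlgebra K A}.

Definition ascale (K : fieldType) (A : assocAlgType K) (a : K) (x : A) : A :=
  acst a * x.
Notation "a *s x" := (ascale a x) (at level 40, left associativity) : ring_scope.

Section AscaleTheory.
Variables (K : fieldType) (A : assocAlgType K).
Implicit Types (a b : K) (x y : A).

Lemma ascale1 x : 1 *s x = x. Proof. by rewrite /ascale acst1 mul1r. Qed.
Lemma ascaleA a b x : a *s (b *s x) = (a * b) *s x.
Proof. by rewrite /ascale acstM mulrA. Qed.
Lemma ascaleDr a x y : a *s (x + y) = a *s x + a *s y.
Proof. exact: mulrDr. Qed.
Lemma ascaler0 a : a *s (0 : A) = 0. Proof. exact: mulr0. Qed.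
Lemma ascaleAl a x y : a *s (x * y) = (a *s x) * y.
Proof. exact: mulrA. Qed.
Lemma ascaleAr a x y : a *s (x * y) = x * (a *s y).
Proof. by rewrite /ascale mulrA acstC -mulrA. Qed.

End AscaleTheory.

Definition comm_br (A : pzRingType) (x y : A) : A := x * y - y * x.
Definition anti_br (A : pzRingType) (x y : A) : A := x * y + y * x.

Record algebra_hom (K : fieldType) (A B : assocAlgType K) (f : A -> B) : Prop :=
  AlgebraHom {
  ahomD : {morph f : x y / x + y};
  ahomZ : forall (a : K) x, f (a *s x) = a *s f x;
  ahom1 : f 1 = 1;
  ahomM : {morph f : x y / x * y}
}.

Record algebra_module (K : fieldType) (A : assocAlgType K) (M : lmodType K)
    (act : A -> M -> M) : Prop := AlgebraModule {
  amod_linear : forall a, linear (act a);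
  amodD : forall a b m, act (a + b) m = act a m + act b m;
  amodZ : forall (k : K) a m, act (k *s a) m = k *: act a m;
  amod1 : forall m, act 1 m = m;
  amodM : forall a b m, act (a * b) m = act a (act b m)
}.

(* W is a linear subspace stable under all the operators act t. *)
Definition is_submodule (K : fieldType) (T : Type) (M : lmodType K)
    (act : T -> M -> M) (W : M -> Prop) : Prop :=
  [/\ W 0,
      forall (a : K) x y, W x -> W y -> W (a *: x + y)
    & forall t x, W x -> W (act t x)].

Definition irreducible (K : fieldType) (T : Type) (M : lmodType K)
    (act : T -> M -> M) : Prop :=
  (exists m : M, m <> 0) /\
  forall W : M -> Prop, is_submodule act W ->
    (forall m, W m -> m = 0) \/ (forall m, W m).

Definition pullback (K : fieldType) (A B : assocAlgType K) (M : lmodType K)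
  (f : A -> B) (act : B -> M -> M) : A -> M -> M := fun a m => act (f a) m.

Lemma pullback_module (K : fieldType) (A B : assocAlgType K) (M : lmodType K)
    (f : A -> B) (act : B -> M -> M) :
  algebra_hom f -> algebra_module act -> algebra_module (pullback f act).
Proof.
case=> fD fZ f1 fM [actl actD actZ act1 actM]; split; rewrite /pullback.
- by move=> a; apply: actl.
- by move=> a b m; rewrite fD actD.
- by move=> k a m; rewrite fZ actZ.
- by move=> m; rewrite f1 act1.
- by move=> a b m; rewrite fM actM.
Qed.

Definition free_alg (K : fieldType) (X : choiceType) := {malg K[{fmonom X}]}.

Section FreeAlg.
Variables (K : fieldType) (X : choiceType).

HB.instance Definition _ := GRing.PzRing.copy (free_alg K X) {malg K[{fmonom X}]}.

Definition free_cst (a : K) : free_alg K X := mkmalgU (mone : {fmonom X}) a.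

Fact free_cst1 : free_cst 1 = 1. Proof. by []. Qed.
Fact free_cstD : {morph free_cst : a b / a + b}.
Proof. exact: monalgUD. Qed.
Fact free_cstM : {morph free_cst : a b / a * b}.
Proof. exact: mpolyCM. Qed.
Fact free_cstC (a : K) (x : free_alg K X) : free_cst a * x = x * free_cst a.
Proof.
apply/malgP => k; rewrite mcoeffCM [in RHS]malgM_def fgmulgU raddf_sum /=.
rewrite [in LHS](monalgE x) raddf_sum mulr_sumr; apply: eq_bigr => i _.
by rewrite /= !mcoeffU mulm1 mulrnAr mulrC.
Qed.

HB.instance Definition _ := isAssocAlgebra.Build K (free_alg K X)
  free_cst1 free_cstD free_cstM free_cstC.

Definition fgen (x : X) : free_alg K X := mkmalgU (fmu x) 1.

End FreeAlg.

Arguments fgen K {X} x.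

Section Quotient.
Variables (K : fieldType) (A : assocAlgType K) (rel : A -> A -> Prop).

Inductive ideal_gen : A -> Prop :=
| ideal_rel x y : rel x y -> ideal_gen (x - y)
| ideal0 : ideal_gen 0
| idealD x y : ideal_gen x -> ideal_gen y -> ideal_gen (x + y)
| idealMl a x : ideal_gen x -> ideal_gen (a * x)
| idealMr a x : ideal_gen x -> ideal_gen (x * a).

Lemma idealN x : ideal_gen x -> ideal_gen (- x).
Proof. by move=> ix; rewrite -mulN1r; apply: idealMl. Qed.

Definition ideal_eq (x y : A) : bool := `[< ideal_gen (x - y) >].

Lemma ideal_eq_refl : reflexive ideal_eq.
Proof. by move=> x; apply/asboolP; rewrite subrr; apply: ideal0. Qed.

Lemma ideal_eq_sym : symmetric ideal_eq.
Proof.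
by move=> x y; apply/asboolP/asboolP => /idealN; rewrite opprB.
Qed.

Lemma ideal_eq_trans : transitive ideal_eq.
Proof.
move=> y x z /asboolP xy /asboolP yz; apply/asboolP.
by rewrite -(subrK y x) -addrA; apply: idealD.
Qed.

Canonical ideal_equiv := EquivRel ideal_eq ideal_eq_refl ideal_eq_sym ideal_eq_trans.

Definition quot_alg := {eq_quot ideal_equiv}.
HB.instance Definition _ := EqQuotient.on quot_alg.
HB.instance Definition _ := Choice.on quot_alg.

Definition qpi (x : A) : quot_alg := \pi x.

Lemma qpiP x y : qpi x = qpi y <-> ideal_gen (x - y).
Proof.
split; first by move=> /eqmodP /asboolP.
by move=> h; apply/eqmodP/asboolP.
Qed.

Lemma qpi_repr u : qpi (repr u) = u.
Proof. exact: reprK. Qed.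

Lemma qrepr_pi x : ideal_gen (repr (qpi x) - x).
Proof. by apply/qpiP; rewrite qpi_repr. Qed.

Definition qadd (u v : quot_alg) := qpi (repr u + repr v).
Definition qopp (u : quot_alg) := qpi (- repr u).
Definition qmul (u v : quot_alg) := qpi (repr u * repr v).
Definition qcst (a : K) := qpi (acst a).

Lemma qaddE x y : qadd (qpi x) (qpi y) = qpi (x + y).
Proof.
by apply/qpiP; rewrite opprD addrACA; apply: idealD; apply: qrepr_pi.
Qed.

Lemma qoppE x : qopp (qpi x) = qpi (- x).
Proof. by apply/qpiP; rewrite -opprD; apply: idealN; apply: qrepr_pi. Qed.

Lemma qmulE x y : qmul (qpi x) (qpi y) = qpi (x * y).
Proof.
apply/qpiP; set x' := repr _; set y' := repr _.
rewrite -(subrK (x' * y) (x' * y')) -addrA -mulrBr -mulrBl.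
by apply: idealD; [apply: idealMl | apply: idealMr]; apply: qrepr_pi.
Qed.

Lemma quot_ind (P : quot_alg -> Prop) : (forall x, P (qpi x)) -> forall u, P u.
Proof. by move=> h u; rewrite -(qpi_repr u). Qed.

Let qE := (qaddE, qoppE, qmulE).

Fact qaddA : associative qadd.
Proof.
by elim/quot_ind=> x; elim/quot_ind=> y; elim/quot_ind=> z; rewrite !qE addrA.
Qed.
Fact qaddC : commutative qadd.
Proof. by elim/quot_ind=> x; elim/quot_ind=> y; rewrite !qE addrC. Qed.
Fact qadd0 : left_id (qpi 0) qadd.
Proof. by elim/quot_ind=> x; rewrite !qE add0r. Qed.
Fact qaddN : left_inverse (qpi 0) qopp qadd.
Proof. by elim/quot_ind=> x; rewrite !qE addNr. Qed.

HB.instance Definition _ := GRing.isZmodule.Build quot_alg qaddA qaddC qadd0 qaddN.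

Fact qmulA : associative qmul.
Proof.
by elim/quot_ind=> x; elim/quot_ind=> y; elim/quot_ind=> z; rewrite !qE mulrA.
Qed.
Fact qmul1 : left_id (qpi 1) qmul.
Proof. by elim/quot_ind=> x; rewrite !qE mul1r. Qed.
Fact q1mul : right_id (qpi 1) qmul.
Proof. by elim/quot_ind=> x; rewrite !qE mulr1. Qed.
Fact qmulDl : left_distributive qmul qadd.
Proof.
by elim/quot_ind=> x; elim/quot_ind=> y; elim/quot_ind=> z; rewrite !qE mulrDl.
Qed.
Fact qmulDr : right_distributive qmul qadd.
Proof.
by elim/quot_ind=> x; elim/quot_ind=> y; elim/quot_ind=> z; rewrite !qE mulrDr.
Qed.

HB.instance Definition _ :=
  GRing.Zmodule_isPzRing.Build quot_alg qmulA qmul1 q1mul qmulDl qmulDr.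

Fact qcst1 : qcst 1 = 1. Proof. by rewrite /qcst acst1. Qed.
Fact qcstD : {morph qcst : a b / a + b}.
Proof. by move=> a b; rewrite /qcst acstD -qaddE. Qed.
Fact qcstM : {morph qcst : a b / a * b}.
Proof. by move=> a b; rewrite /qcst acstM -qmulE. Qed.
Fact qcstC (a : K) (u : quot_alg) : qcst a * u = u * qcst a.
Proof. by elim/quot_ind: u => x; rewrite /GRing.mul /= !qE acstC. Qed.

HB.instance Definition _ :=
  isAssocAlgebra.Build K quot_alg qcst1 qcstD qcstM qcstC.

Lemma qpi_hom : algebra_hom qpi.
Proof.
split=> // [x y|a x|x y]; first by rewrite -qaddE.
  by rewrite /ascale -qmulE.
by rewrite -qmulE.
Qed.

Lemma qpi_rel x y : rel x y -> qpi x = qpi y.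
Proof. by move=> h; apply/qpiP; apply: ideal_rel. Qed.

End Quotient.

Definition presented (K : fieldType) (X : choiceType)
  (rel : free_alg K X -> free_alg K X -> Prop) : assocAlgType K := quot_alg rel.

Definition pres_gen (K : fieldType) (X : choiceType)
  (rel : free_alg K X -> free_alg K X -> Prop) (x : X) : presented rel :=
  qpi rel (fgen K x).

(* Completion of a Z-graded algebra A = (+)_d A[d]:                          *)
(*   (+)_d lim_n A[d] / I_n[d],  I_n[d] = sum_(r > n) A[d + r] A[- r].       *)

Record grading (K : fieldType) (A : assocAlgType K) := Grading {
  gdeg :> int -> A -> Prop;
  gdeg0 : forall d, gdeg d 0;
  gdegD : forall d x y, gdeg d x -> gdeg d y -> gdeg d (x + y);
  gdegZ : forall d (a : K) x, gdeg d x -> gdeg d (a *s x);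
  gdeg1 : gdeg 0 1;
  gdegM : forall d e x y, gdeg d x -> gdeg e y -> gdeg (d + e) (x * y)
}.

Section Support.

Definition zrange (B : nat) : seq int :=
  [seq i%:Z - B%:Z | i <- iota 0 (B + B).+1].

Lemma mem_zrange B e : (e \in zrange B) = (`|e|%N <= B)%N.
Proof.
apply/mapP/idP => [[k]|le].
  by rewrite mem_iota add0n => /andP[_ ilt] ->; lia.
exists `|(e + B%:Z)%R|%N; last by lia.
by rewrite mem_iota add0n /=; lia.
Qed.

Lemma zrange_uniq B : uniq (zrange B).
Proof. by rewrite map_inj_uniq ?iota_uniq // => i j /=; lia. Qed.

Lemma eq_big_supp (V : zmodType) (s t : seq int) (F : int -> V) :
  uniq s -> uniq t -> (forall e, F e != 0 -> e \in s) ->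
  (forall e, F e != 0 -> e \in t) ->
  \sum_(e <- s) F e = \sum_(e <- t) F e.
Proof.
move=> us ut Fs Ft.
have filt0 (r : seq int) : \sum_(e <- r) F e = \sum_(e <- r | F e != 0) F e.
  rewrite (bigID (fun e => F e != 0)) /= [X in _ + X]big1 ?addr0 //.
  by move=> e; rewrite negbK => /eqP.
rewrite filt0 [RHS]filt0 -big_filter -[RHS]big_filter; apply: perm_big.
apply: uniq_perm; rewrite ?filter_uniq // => e; rewrite !mem_filter.
by case: (boolP (F e != 0)) => //= h; rewrite Fs // Ft.
Qed.

End Support.

Section Completion.
Variables (K : fieldType) (A : assocAlgType K) (G : grading A).
Implicit Types (d e : int) (n m : nat).

Lemma gdegN d x : G d x -> G d (- x).
Proof.
move=> gx; rewrite -mulN1r.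
suff -> : -1 = acst (-1) :> A by exact: gdegZ.
by apply/eqP; rewrite eq_sym -subr_eq0 opprK -[X in _ + X]acst1 -acstD addNr;
  apply/eqP/(addrI (acst 0)); rewrite -acstD !addr0.
Qed.

Lemma gdegB d x y : G d x -> G d y -> G d (x - y).
Proof. by move=> gx gy; apply: gdegD => //; apply: gdegN. Qed.

Lemma gdeg_sum d (I : Type) (r : seq I) (P : pred I) (F : I -> A) :
  (forall i, P i -> G d (F i)) -> G d (\sum_(i <- r | P i) F i).
Proof.
by move=> h; elim/big_ind: _ => //; [exact: gdeg0 | exact: gdegD].
Qed.

Lemma gdeg_sumM d (s : seq int) (F H : int -> A) :
  (forall e, G e (F e)) -> (forall e, G (d - e) (H e)) ->
  G d (\sum_(e <- s) F e * H e).
Proof.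
move=> gF gH; apply: gdeg_sum => e _.
by have := gdegM (gF e) (gH e); rewrite addrC subrK.
Qed.

Inductive filt (n : nat) (d : int) : A -> Prop :=
| filt0 : filt n d 0
| filtD x y : filt n d x -> filt n d y -> filt n d (x + y)
| filtM (r : nat) a b :
    (n < r)%N -> G (d + r%:Z) a -> G (- r%:Z) b -> filt n d (a * b).

Lemma filtMM n d k e x y :
  k = d + e -> filt n d x -> forall m, (m + `|e|%N <= n)%N -> G e y ->
  filt m k (x * y).
Proof.
move=> -> + m mn gy; elim=> [|x1 x2 _ h1 _ h2|r a b nr ga gb].
- by rewrite mul0r; apply: filt0.
- by rewrite mulrDl; apply: filtD.
have [r' r'E] : exists r' : nat, r'%:Z = r%:Z - e by exists `|(r%:Z - e)%R|%N; lia.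
rewrite -mulrA; apply: (@filtM m _ r'); first by lia.
  by rewrite r'E; suff -> : d + e + (r%:Z - e) = d + r%:Z by []; lia.
by rewrite r'E; suff -> : - (r%:Z - e) = - r%:Z + e; [exact: gdegM | lia].
Qed.

Lemma filtMl n d k e x y :
  k = e + d -> G e x -> filt n d y -> filt n k (x * y).
Proof.
move=> -> gx; elim=> [|y1 y2 _ h1 _ h2|r a b nr ga gb].
- by rewrite mulr0; apply: filt0.
- by rewrite mulrDr; apply: filtD.
by rewrite mulrA; apply: (filtM nr) => //; rewrite -addrA; apply: gdegM.
Qed.

Lemma filt_le m n d x : (m <= n)%N -> filt n d x -> filt m d x.
Proof.
move=> mn; elim=> [|x1 x2 _ h1 _ h2|r a b nr ga gb].
- exact: filt0.
- exact: filtD.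
by apply: (@filtM m _ r) => //; apply: leq_ltn_trans nr.
Qed.

Lemma filt_deg n d x : filt n d x -> G d x.
Proof.
elim=> [|x1 x2 _ h1 _ h2|r a b nr ga gb].
- exact: gdeg0.
- exact: gdegD.
by have := gdegM ga gb; rewrite addrK.
Qed.

Lemma filtN n d x : filt n d x -> filt n d (- x).
Proof.
elim=> [|x1 x2 _ h1 _ h2|r a b nr ga gb].
- by rewrite oppr0; apply: filt0.
- by rewrite opprD; apply: filtD.
by rewrite -mulNr; apply: (filtM nr) => //; apply: gdegN.
Qed.

Lemma filtB n d x y : filt n d x -> filt n d y -> filt n d (x - y).
Proof. by move=> hx hy; apply: filtD => //; apply: filtN. Qed.

Lemma filt_sum n d (I : eqType) (r : seq I) (F : I -> A) :
  (forall i, i \in r -> filt n d (F i)) -> filt n d (\sum_(i <- r) F i).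
Proof.
move=> h; rewrite big_seq; elim/big_ind: _ => //; [exact: filt0 | exact: filtD].
Qed.

(* An element of lim_n A[d] / I_n[d] is represented by a sequence cval d n   *)
(* of representatives in A[d], where cval d n.+1 and cval d n agree in       *)
(* A[d] / I_n[d].  Only finitely many degrees d are nonzero.                 *)
Record cseq := CSeq {
  cval :> int -> nat -> A;
  cbnd : nat;
  cval_deg : forall d n, G d (cval d n);
  cval_step : forall d n, filt n d (cval d n.+1 - cval d n);
  cval_supp : forall d n, (cbnd < `|d|%N)%N -> cval d n = 0
}.

HB.instance Definition _ := gen_eqMixin cseq.
HB.instance Definition _ := gen_choiceMixin cseq.

Lemma cval_le (u : cseq) d m n : (m <= n)%N -> filt m d (u d n - u d m).
Proof.
elim: n => [|n IH]; first by rewrite leqn0 => /eqP ->; rewrite subrr; apply: filt0.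
rewrite leq_eqVlt => /orP[/eqP ->|]; first by rewrite subrr; apply: filt0.
rewrite ltnS => mn; rewrite -(subrK (u d n) (u d n.+1)) -addrA.
by apply: filtD; [apply: filt_le mn _; apply: cval_step | apply: IH].
Qed.

Lemma cval_le2 (u : cseq) d k m n :
  (k <= m)%N -> (k <= n)%N -> filt k d (u d m - u d n).
Proof.
move=> km kn; rewrite -(subrK (u d k) (u d m)) -addrA -[u d k - _]opprB.
by apply: filtB; apply: cval_le.
Qed.

Lemma cval_neq0 (u : cseq) d n : u d n != 0 -> (`|d|%N <= cbnd u)%N.
Proof. by rewrite leqNgt; apply: contra => /cval_supp ->. Qed.

Definition ceq (u v : cseq) : bool := `[< forall d n, filt n d (u d n - v d n) >].

Lemma ceqP (u v : cseq) : reflect (forall d n, filt n d (u d n - v d n)) (ceq u v).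
Proof. exact: asboolP. Qed.

Lemma ceq_refl : reflexive ceq.
Proof. by move=> u; apply/ceqP => d n; rewrite subrr; apply: filt0. Qed.
Lemma ceq_sym : symmetric ceq.
Proof.
by move=> u v; apply/ceqP/ceqP => h d n; rewrite -opprB; apply: filtN.
Qed.
Lemma ceq_trans : transitive ceq.
Proof.
move=> v u w /ceqP uv /ceqP vw; apply/ceqP => d n.
by rewrite -(subrK (v d n) (u d n)) -addrA; apply: filtD.
Qed.

Canonical ceq_equiv := EquivRel ceq ceq_refl ceq_sym ceq_trans.

Definition completion := {eq_quot ceq_equiv}.
HB.instance Definition _ := EqQuotient.on completion.
HB.instance Definition _ := Choice.on completion.

Definition cpi (u : cseq) : completion := \pi u.

Lemma cpiP (u v : cseq) : cpi u = cpi v <-> forall d n, filt n d (u d n - v d n).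
Proof.
split; first by move=> /eqmodP /ceqP.
by move=> h; apply/eqmodP/ceqP.
Qed.

Lemma cpi_eq (u v : cseq) : u =2 v -> cpi u = cpi v.
Proof. by move=> h; apply/cpiP => d n; rewrite h subrr; apply: filt0. Qed.

Lemma cpi_repr (x : completion) : cpi (repr x) = x.
Proof. exact: reprK. Qed.

Lemma crepr_pi (u : cseq) d n : filt n d (repr (cpi u) d n - u d n).
Proof. by move: d n; apply/cpiP; rewrite cpi_repr. Qed.

Lemma comp_ind (P : completion -> Prop) : (forall u, P (cpi u)) -> forall x, P x.
Proof. by move=> h x; rewrite -(cpi_repr x). Qed.

Definition hseq_ok d (u : nat -> A) :=
  (forall n, G d (u n)) /\ (forall n, filt n d (u n.+1 - u n)).

Section Homogeneous.
Variables (d : int) (u : nat -> A) (uP : hseq_ok d u).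

Definition hval e n := if e == d then u n else 0.

Fact hval_deg e n : G e (hval e n).
Proof. by rewrite /hval; case: eqP => [->|_]; [exact: uP.1 | exact: gdeg0]. Qed.
Fact hval_step e n : filt n e (hval e n.+1 - hval e n).
Proof.
rewrite /hval; case: eqP => [->|_]; first exact: uP.2.
by rewrite subrr; apply: filt0.
Qed.
Fact hval_supp e n : (`|d|%N < `|e|%N)%N -> hval e n = 0.
Proof. by rewrite /hval; case: eqP => // ->; rewrite ltnn. Qed.

Definition hseq := CSeq hval_deg hval_step hval_supp.

End Homogeneous.

Fact const_ok d a : G d a -> hseq_ok d (fun=> a).
Proof. by split=> // n; rewrite subrr; apply: filt0. Qed.

Fact partial_sum_ok d (t : nat -> A) :
  (forall s, G d (t s)) -> (forall s, filt s d (t s.+1)) ->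
  hseq_ok d (fun n => \sum_(s < n.+1) t s).
Proof.
move=> tG tI; split=> n; first exact: gdeg_sum.
by rewrite [X in X - _]big_ord_recr /= [X in X - _]addrC addrK.
Qed.

Definition comp_of d a (ga : G d a) : completion := cpi (hseq (const_ok ga)).

Lemma acst_deg (a : K) : G 0 (acst a).
Proof. by rewrite -[acst a]mulr1; apply: gdegZ; apply: gdeg1. Qed.

(* The infinite sum sum_(s >= 0) t s, for t s in A[d] with t s.+1 in I_s[d]. *)
Definition comp_sum d (t : nat -> A) (tG : forall s, G d (t s))
    (tI : forall s, filt s d (t s.+1)) : completion :=
  cpi (hseq (partial_sum_ok tG tI)).

Section Operations.
Variables u v : cseq.

Definition cadd_val d n := u d n + v d n.
Fact cadd_deg d n : G d (cadd_val d n).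
Proof. by apply: gdegD; apply: cval_deg. Qed.
Fact cadd_step d n : filt n d (cadd_val d n.+1 - cadd_val d n).
Proof. by rewrite opprD addrACA; apply: filtD; apply: cval_step. Qed.
Fact cadd_supp d n : (maxn (cbnd u) (cbnd v) < `|d|%N)%N -> cadd_val d n = 0.
Proof.
by rewrite gtn_max => /andP[h1 h2]; rewrite /cadd_val !cval_supp // addr0.
Qed.
Definition cadd := CSeq cadd_deg cadd_step cadd_supp.

Definition copp_val d n := - u d n.
Fact copp_deg d n : G d (copp_val d n).
Proof. by apply: gdegN; apply: cval_deg. Qed.
Fact copp_step d n : filt n d (copp_val d n.+1 - copp_val d n).
Proof. by rewrite -opprD; apply: filtN; apply: cval_step. Qed.
Fact copp_supp d n : (cbnd u < `|d|%N)%N -> copp_val d n = 0.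
Proof. by move=> h; rewrite /copp_val cval_supp // oppr0. Qed.
Definition copp := CSeq copp_deg copp_step copp_supp.

(* Right multiplication by A[d - e] maps I_(n + |d - e|)[e] into I_n[d], so  *)
(* the left factor has to be known modulo I_(n + |d - e|)[e].                *)
Definition cmul_val d n :=
  \sum_(e <- zrange (cbnd u)) u e (n + `|(d - e)%R|)%N * v (d - e) n.
Fact cmul_deg d n : G d (cmul_val d n).
Proof. by apply: gdeg_sumM => e; apply: cval_deg. Qed.
Fact cmul_step d n : filt n d (cmul_val d n.+1 - cmul_val d n).
Proof.
rewrite /cmul_val -sumrB; apply: filt_sum => e _.
set k := `|(d - e)%R|%N.
rewrite -(subrK (u e (n + k)%N * v (d - e) n.+1) (_ * v (d - e) n.+1)).
rewrite -addrA -mulrBl -mulrBr; apply: filtD.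
  apply: (@filtMM (n + k)%N e d (d - e)) => //; first by rewrite addrC subrK.
    exact: cval_step.
  exact: cval_deg.
apply: (@filtMl n (d - e) d e); first by rewrite addrC subrK.
  exact: cval_deg.
exact: cval_step.
Qed.
Fact cmul_supp d n : (cbnd u + cbnd v < `|d|%N)%N -> cmul_val d n = 0.
Proof.
move=> h; rewrite /cmul_val big_seq big1 // => e; rewrite mem_zrange => he.
by rewrite [v _ _]cval_supp ?mulr0 //; lia.
Qed.
Definition cmul := CSeq cmul_deg cmul_step cmul_supp.

End Operations.

Lemma cmul_valE (u v : cseq) B d n : (cbnd u <= B)%N ->
  cmul u v d n = \sum_(e <- zrange B) u e (n + `|(d - e)%R|)%N * v (d - e) n.
Proof.
move=> uB; apply: eq_big_supp; rewrite ?zrange_uniq // => e.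
  rewrite mem_zrange => h; apply: (@cval_neq0 u e (n + `|(d - e)%R|)%N).
  by apply: contraNneq h => ->; rewrite mul0r.
rewrite mem_zrange => h; apply: leq_trans uB.
apply: (@cval_neq0 u e (n + `|(d - e)%R|)%N).
by apply: contraNneq h => ->; rewrite mul0r.
Qed.

Definition compadd (x y : completion) := cpi (cadd (repr x) (repr y)).
Definition compopp (x : completion) := cpi (copp (repr x)).
Definition compmul (x y : completion) := cpi (cmul (repr x) (repr y)).
Definition compcst (a : K) : completion := comp_of (acst_deg a).
Definition comp0 : completion := comp_of (gdeg0 G 0).
Definition comp1 : completion := comp_of (gdeg1 G).

Lemma compaddE u v : compadd (cpi u) (cpi v) = cpi (cadd u v).
Proof.
by apply/cpiP => d n; rewrite opprD addrACA; apply: filtD; apply: crepr_pi.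
Qed.

Lemma compoppE u : compopp (cpi u) = cpi (copp u).
Proof. by apply/cpiP => d n; rewrite -opprD; apply/filtN/crepr_pi. Qed.

Lemma compmulE u v : compmul (cpi u) (cpi v) = cpi (cmul u v).
Proof.
apply/cpiP => d n; set u' := repr _; set v' := repr _.
pose B := maxn (cbnd u') (cbnd u).
rewrite (@cmul_valE _ _ B) ?leq_maxl // (@cmul_valE _ _ B) ?leq_maxr //.
rewrite -sumrB; apply: filt_sum => e _; set k := `|(d - e)%R|%N.
rewrite -(subrK (u e (n + k)%N * v' (d - e) n) (_ * v' (d - e) n)).
rewrite -addrA -mulrBl -mulrBr; apply: filtD.
  apply: (@filtMM (n + k)%N e d (d - e)) => //; first by rewrite addrC subrK.
    exact: crepr_pi.
  exact: cval_deg.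
apply: (@filtMl n (d - e) d e); first by rewrite addrC subrK.
  exact: cval_deg.
exact: crepr_pi.
Qed.

Let cE := (compaddE, compoppE, compmulE).

Fact compaddA : associative compadd.
Proof.
elim/comp_ind=> u; elim/comp_ind=> v; elim/comp_ind=> w; rewrite !cE.
by apply: cpi_eq => d n; apply: addrA.
Qed.
Fact compaddC : commutative compadd.
Proof.
elim/comp_ind=> u; elim/comp_ind=> v; rewrite !cE.
by apply: cpi_eq => d n; apply: addrC.
Qed.
Fact compadd0 : left_id comp0 compadd.
Proof.
elim/comp_ind=> u; rewrite /comp0 /comp_of cE; apply: cpi_eq => d n.
by rewrite /= /cadd_val /= /hval if_same add0r.
Qed.
Fact compaddN : left_inverse comp0 compopp compadd.
Proof.
elim/comp_ind=> u; rewrite !cE; apply: cpi_eq => d n.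
by rewrite /= /cadd_val /= /copp_val /hval if_same addNr.
Qed.

HB.instance Definition _ :=
  GRing.isZmodule.Build completion compaddA compaddC compadd0 compaddN.

Lemma cmul_constl a (ga : G 0 a) (u : cseq) d n :
  cmul (hseq (const_ok ga)) u d n = a * u d n.
Proof.
rewrite (@cmul_valE _ _ 0) // /zrange /= big_seq1 /= /hval subrr eqxx.
by rewrite subr0.
Qed.

Lemma cmul_constr a (ga : G 0 a) (u : cseq) d n :
  cmul u (hseq (const_ok ga)) d n = u d n * a.
Proof.
rewrite [LHS]/= /cmul_val (@eq_big_supp _ _ [:: d]) ?zrange_uniq //; first last.
- move=> e; rewrite inE; apply: contraNT => ne.
  by rewrite /= /hval subr_eq0 [d == e]eq_sym (negbTE ne) mulr0.
- move=> e h; rewrite mem_zrange.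
  apply: (@cval_neq0 u e (n + `|(d - e)%R|)%N).
  by apply: contraNneq h => ->; rewrite mul0r.
by rewrite big_seq1 /= /hval subrr eqxx addn0.
Qed.

Fact compmulA : associative compmul.
Proof.
elim/comp_ind=> u; elim/comp_ind=> v; elim/comp_ind=> w; rewrite !cE.
apply/cpiP => d n; rewrite [X in _ - X]/= [X in X - _]/= /cmul_val.
under [X in _ - X]eq_bigr => e _.
  rewrite [cmul u v _ _]/= /cmul_val mulr_suml.
  over.
rewrite exchange_big /= -sumrB; apply: filt_sum => e'; rewrite mem_zrange => he'.
rewrite /cmul_val mulr_sumr.
set F := fun f : int => u e' (n + `|(d - e')%R|)%N *
  (v f (n + `|(d - e' - f)%R|)%N * w (d - e' - f) n).
have -> : \sum_(f <- zrange (cbnd v)) F f =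
          \sum_(e <- zrange (cbnd u + cbnd v)) F (e - e').
  rewrite -(big_map (fun e => e - e') xpredT F).
  have vF f : F f != 0 -> (`|f|%N <= cbnd v)%N.
    move=> h; apply: (@cval_neq0 v f (n + `|(d - e' - f)%R|)%N).
    by apply: contraNneq h; rewrite /F => ->; rewrite mul0r mulr0.
  apply: eq_big_supp; rewrite ?zrange_uniq //.
  - by rewrite map_inj_uniq ?zrange_uniq // => a b; apply: addIr.
  - by move=> f /vF; rewrite mem_zrange.
  move=> f /vF hf; apply/mapP; exists (f + e'); last by rewrite addrK.
  by rewrite mem_zrange; lia.
rewrite -sumrB; apply: filt_sum => e _; rewrite /F.
have -> : d - e' - (e - e') = d - e by lia.
rewrite -mulrA -mulrBl.
apply: (@filtMM (n + `|(d - e')%R|)%N e' d (d - e')) => //.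
- by rewrite addrC subrK.
- by apply: cval_le2 => //; lia.
have -> : d - e' = (e - e') + (d - e) by lia.
by apply: gdegM; apply: cval_deg.
Qed.
Fact compmul1 : left_id comp1 compmul.
Proof.
elim/comp_ind=> u; rewrite /comp1 /comp_of cE; apply: cpi_eq => d n.
by rewrite cmul_constl mul1r.
Qed.
Fact comp1mul : right_id comp1 compmul.
Proof.
elim/comp_ind=> u; rewrite /comp1 /comp_of cE; apply: cpi_eq => d n.
by rewrite cmul_constr mulr1.
Qed.
Fact compmulDl : left_distributive compmul +%R.
Proof.
elim/comp_ind=> u; elim/comp_ind=> v; elim/comp_ind=> w.
rewrite /GRing.add /= !cE; apply: cpi_eq => d n.
pose B := maxn (cbnd u) (cbnd v).
rewrite [RHS]/= /cadd_val !(@cmul_valE _ _ B) ?leq_maxl ?leq_maxr //.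
by rewrite -big_split; apply: eq_bigr => e _; rewrite /= /cadd_val mulrDl.
Qed.
Fact compmulDr : right_distributive compmul +%R.
Proof.
elim/comp_ind=> u; elim/comp_ind=> v; elim/comp_ind=> w.
rewrite /GRing.add /= !cE; apply: cpi_eq => d n.
rewrite /= /cadd_val /= /cmul_val -big_split; apply: eq_bigr => e _.
by rewrite /= /cadd_val mulrDr.
Qed.

HB.instance Definition _ := GRing.Zmodule_isPzRing.Build completion
  compmulA compmul1 comp1mul compmulDl compmulDr.

Fact compcst1 : compcst 1 = 1.
Proof. by apply: cpi_eq => d n; rewrite /= /hval acst1. Qed.
Fact compcstD : {morph compcst : a b / a + b}.
Proof.
move=> a b; rewrite [in RHS]/GRing.add /= cE; apply: cpi_eq => d n.
by rewrite /= /cadd_val /= /hval acstD; case: ifP; rewrite ?addr0.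
Qed.
Fact compcstM : {morph compcst : a b / a * b}.
Proof.
move=> a b; rewrite [in RHS]/GRing.mul /= cE; apply: cpi_eq => d n.
by rewrite cmul_constl /= /hval acstM; case: ifP; rewrite ?mulr0.
Qed.
Fact compcstC (a : K) (x : completion) : compcst a * x = x * compcst a.
Proof.
elim/comp_ind: x => u; rewrite /GRing.mul /= !cE; apply: cpi_eq => d n.
by rewrite cmul_constl cmul_constr acstC.
Qed.

HB.instance Definition _ := isAssocAlgebra.Build K completion
  compcst1 compcstD compcstM compcstC.

End Completion.

(* The affine Yangian Y(sl_N^).  Z/N is 'I_N with ordS and ord_pred.         *)

(* YX true i r is x^+_(i,r), YX false i r is x^-_(i,r), YH i r is h_(i,r).   *)
Variant ygen (N : nat) :=
| YX of bool & 'I_N & nat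
| YH of 'I_N & nat.

Section YGenChoice.
Variable N : nat.

Definition ygen_code (g : ygen N) : (bool * 'I_N * nat) + ('I_N * nat) :=
  match g with YX b i r => inl (b, i, r) | YH i r => inr (i, r) end.
Definition ygen_decode (x : (bool * 'I_N * nat) + ('I_N * nat)) : ygen N :=
  match x with inl (b, i, r) => YX b i r | inr (i, r) => YH i r end.
Lemma ygen_codeK : cancel ygen_code ygen_decode. Proof. by case. Qed.

HB.instance Definition _ := Choice.copy (ygen N) (can_type ygen_codeK).

End YGenChoice.

Section Yangian.
Variables (K : fieldType) (N : nat) (eps1 eps2 : K).

Definition cartan (i j : 'I_N) : int :=
  if i == j then 2
  else if (i == ordS j) || (i == ord_pred j) then -1 else 0.

Definition mskew (i j : 'I_N) : int :=
  if j == ord_pred i then 1 else if j == ordS i then -1 else 0.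

Definition pm (b : bool) : int := if b then 1 else -1.

Local Notation F := (free_alg K (ygen N)).
Local Notation x b i r := (fgen K (YX b i r) : F).
Local Notation h i r := (fgen K (YH i r) : F).

Definition serre_size (i j : 'I_N) : nat := `|1 - cartan i j|%N.

(* [x_(i,r_w(1)), [x_(i,r_w(2)), ... [x_(i,r_w(m)), x_(j,s)] ... ]]          *)
Definition serre_term b (i j : 'I_N) (r : 'I_(serre_size i j) -> nat) (s : nat)
    (w : 'S_(serre_size i j)) : F :=
  foldr (fun k y => comm_br (x b i (r (w k))) y) (x b j s)
        (enum 'I_(serre_size i j)).

Definition wsum (i j : 'I_N) (b : bool) (u v : F) : F :=
  ((pm b * cartan i j)%:~R * ((eps1 + eps2) / 2)) *s anti_br u v
  - ((mskew i j)%:~R * ((eps1 - eps2) / 2)) *s comm_br u v.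

Inductive yangian_rel : F -> F -> Prop :=
| y_hh i j r s : yangian_rel (comm_br (h i r) (h j s)) 0
| y_xx i j r s :
    yangian_rel (comm_br (x true i r) (x false j s))
                (if i == j then h i (r + s)%N else 0)
| y_h0x b i j r :
    yangian_rel (comm_br (h i 0%N) (x b j r))
                ((pm b * cartan i j)%:~R *s x b j r)
| y_hx b i j r s :
    yangian_rel (comm_br (h i r.+1) (x b j s) - comm_br (h i r) (x b j s.+1))
                (wsum i j b (h i r) (x b j s))
| y_x2 b i j r s :
    yangian_rel (comm_br (x b i r.+1) (x b j s) - comm_br (x b i r) (x b j s.+1))
                (wsum i j b (x b i r) (x b j s))
| y_serre b i j (r : 'I_(serre_size i j) -> nat) s :
    i != j -> yangian_rel (\sum_(w : 'S_(serre_size i j)) serre_term b r s w) 0.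

Definition yangian : assocAlgType K := presented yangian_rel.

Definition y_x b (i : 'I_N) r : yangian := pres_gen yangian_rel (YX b i r).
Definition y_h (i : 'I_N) r : yangian := pres_gen yangian_rel (YH i r).

End Yangian.

(* The affine Lie algebra gl_N^.  An element is a pair (f, z), standing for  *)
(* f + z c, where f is a Laurent polynomial in t with matrix coefficients    *)
(* (a finitely supported function int -> 'M_N).                              *)

Definition affgl (K : fieldType) (N : nat) : Type :=
  ({malg 'M[K]_N[int]} * K)%type.

Section AffineGl.
Variables (K : fieldType) (N : nat).
Local Notation L := (affgl K N).
Implicit Types (X Y : 'M[K]_N) (r s : int).

HB.instance Definition _ :=
  GRing.Zmodule.copy L ({malg 'M[K]_N[int]} * K)%type.

Definition loop_scale (a : K) (f : {malg 'M[K]_N[int]}) : {malg 'M[K]_N[int]} :=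
  \sum_(r <- msupp f) << a *: f@_r *g r >>.

Lemma loop_scaleE a f r : (loop_scale a f)@_r = a *: f@_r.
Proof.
rewrite [in RHS](monalgE f) !raddf_sum /=; apply: eq_bigr => s _.
by rewrite !mcoeffU scalerMnr.
Qed.

Definition aff_scale (a : K) (x : L) : L := (loop_scale a x.1, a * x.2).

Fact aff_scaleA a b x : aff_scale a (aff_scale b x) = aff_scale (a * b) x.
Proof.
rewrite /aff_scale /= mulrA; congr (_, _).
by apply/malgP => r; rewrite !loop_scaleE scalerA.
Qed.
Fact aff_scale1 : left_id 1 aff_scale.
Proof.
move=> [f z]; rewrite /aff_scale /= mul1r; congr (_, _).
by apply/malgP => r; rewrite !loop_scaleE scale1r.
Qed.
Fact aff_scaleDr : right_distributive aff_scale +%R.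
Proof.
move=> a x y; rewrite /aff_scale /= mulrDr; congr (_, _).
by apply/malgP => r; rewrite mcoeffD !loop_scaleE mcoeffD scalerDr.
Qed.
Fact aff_scaleDl x : {morph aff_scale^~ x : a b / a + b}.
Proof.
move=> a b; rewrite /aff_scale /= mulrDl; congr (_, _).
by apply/malgP => r; rewrite mcoeffD !loop_scaleE scalerDl.
Qed.

HB.instance Definition _ := GRing.Zmodule_isLmodule.Build K L
  aff_scaleA aff_scale1 aff_scaleDr aff_scaleDl.

(* X(r) = X (x) t^r, and the central element c.                              *)
Definition aff_loop X r : L := (<< X *g r >>, 0).
Definition aff_c : L := (0, 1).

Definition aff_br (x y : L) : L :=
  (\sum_(r <- msupp x.1) \sum_(s <- msupp y.1)
      << x.1@_r *m y.1@_s - y.1@_s *m x.1@_r *g r + s >>,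
   \sum_(r <- msupp x.1) r%:~R * \tr (x.1@_r *m y.1@_(- r))).

Lemma aff_br_loop X Y r s :
  aff_br (aff_loop X r) (aff_loop Y s) =
    aff_loop (X *m Y - Y *m X) (r + s)
    + (if r + s == 0 then r%:~R * \tr (X *m Y) else 0) *: aff_c.
Proof.
have suppE Z q (V : zmodType) (H : int -> V) :
    (Z = 0 -> H q = 0) ->
    \sum_(p <- msupp (<< Z *g q >> : {malg 'M[K]_N[int]})) H p = H q.
  move=> H0; rewrite msuppU; case: eqP => [/H0 ->|_]; last by rewrite big_seq_fset1.
  by rewrite big_seq_fset0.
congr (_, _).
  rewrite /= suppE; last first.
    move=> ->; rewrite big1 // => p _.
    by rewrite monalgU0 mcoeff0 mul0mx mulmx0 subrr monalgU0.
  rewrite suppE; last first.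
    by move=> ->; rewrite monalgU0 mcoeff0 mul0mx mulmx0 subrr monalgU0.
  rewrite !mcoeffUU -[LHS]addr0; congr (_ + _).
  by apply/esym/malgP => k; rewrite loop_scaleE mcoeff0 scaler0.
rewrite /= suppE; last by move=> ->; rewrite mcoeffUU mul0mx mxtrace0 mulr0.
rewrite mcoeffUU add0r mulr1 mcoeffU.
have -> : (s == - r) = (r + s == 0) by lia.
by case: eqP => _; rewrite ?mulr1n // mulr0n mulmx0 mxtrace0 mulr0.
Qed.

(* The matrix unit E_(k,l), with indices read modulo N; the index N is the   *)
(* class of 0.                                                               *)
Definition mxE_mod (k l : nat) : 'M[K]_N :=
  \matrix_(a < N, b < N) ((a == k %% N :> nat)%N && (b == l %% N :> nat)%N)%:R.

Local Notation E k l := (mxE_mod k l).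

(* Chevalley generators; i = 0 is the affine node.                           *)
Definition aff_x (b : bool) (i : nat) : L :=
  if i == 0%N then
    if b then aff_loop (E N 1%N) 1 else aff_loop (E 1%N N) (-1)
  else
    if b then aff_loop (E i i.+1) 0 else aff_loop (E i.+1 i) 0.

Definition aff_h (i : nat) : L :=
  if i == 0%N then aff_loop (E N N - E 1%N 1%N) 0 + aff_c
  else aff_loop (E i i - E i.+1 i.+1) 0.

Record lie_module (M : lmodType K) (rho : L -> M -> M) : Prop := LieModule {
  lie_linear : forall x, linear (rho x);
  lie_linearl : forall m, linear (rho^~ m);
  lie_brE : forall x y m, rho (aff_br x y) m = rho x (rho y m) - rho y (rho x m)
}.

End AffineGl.

Arguments aff_c {K N}.

Section Enveloping.
Variables (K : fieldType) (N : nat) (c : K).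
Local Notation L := (affgl K N).
Local Notation F := (free_alg K L).
Local Notation g := (fgen K).

Inductive env_rel : F -> F -> Prop :=
| env_linear (a : K) (x y : L) : env_rel (g (a *: x + y)) (a *s g x + g y)
| env_br (x y : L) : env_rel (g (aff_br x y)) (comm_br (g x) (g y))
| env_c : env_rel (g aff_c) (acst c).

Definition env : assocAlgType K := presented env_rel.

Definition env_in (x : L) : env := pres_gen env_rel x.

(* U[d] is spanned by the products X_1(s_1) ... X_k(s_k), s_1 + ... + s_k = d. *)
Inductive env_mono : int -> env -> Prop :=
| env_mono1 : env_mono 0 1
| env_monoM X s d m :
    env_mono d m -> env_mono (s + d) (env_in (aff_loop X s) * m).

Inductive env_deg (d : int) : env -> Prop :=
| env_deg0 : env_deg d 0
| env_degD (a : K) m x : env_mono d m -> env_deg d x -> env_deg d (a *s m + x).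

Fact env_deg_add d x y : env_deg d x -> env_deg d y -> env_deg d (x + y).
Proof.
move=> hx hy; elim: hx => [|a m z hm _ IH]; first by rewrite add0r.
by rewrite -addrA; apply: env_degD.
Qed.

Fact env_deg_scale d (a : K) x : env_deg d x -> env_deg d (a *s x).
Proof.
elim=> [|b m z hm _ IH]; first by rewrite ascaler0; apply: env_deg0.
by rewrite ascaleDr ascaleA; apply: env_degD.
Qed.

Lemma env_mono_deg d m : env_mono d m -> env_deg d m.
Proof.
move=> hm; rewrite -[m]addr0 -[m]ascale1.
by apply: env_degD => //; apply: env_deg0.
Qed.

Fact env_deg_one : env_deg 0 1.
Proof. by apply: env_mono_deg; apply: env_mono1. Qed.

Lemma env_monoMM d e m p : env_mono d m -> env_mono e p -> env_mono (d + e) (m * p).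
Proof.
move=> hm hp; elim: hm => [|X s d' m' _ IH]; first by rewrite add0r mul1r.
by rewrite -addrA -mulrA; apply: env_monoM.
Qed.

Fact env_deg_mul d e x y : env_deg d x -> env_deg e y -> env_deg (d + e) (x * y).
Proof.
move=> hx hy; elim: hx => [|a m z hm _ IH]; first by rewrite mul0r; apply: env_deg0.
rewrite mulrDl; apply: env_deg_add; last exact: IH.
rewrite -ascaleAl; apply: env_deg_scale; elim: hy => [|b p w hp _ IHw].
  by rewrite mulr0; apply: env_deg0.
rewrite mulrDr; apply: env_deg_add; last exact: IHw.
rewrite -ascaleAr; apply: env_deg_scale; apply: env_mono_deg.
exact: env_monoMM.
Qed.

Definition env_grading : grading env :=
  Grading env_deg0 env_deg_add env_deg_scale env_deg_one env_deg_mul.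

Definition env_comp : assocAlgType K := completion env_grading.

Lemma env_loop_deg X s : env_grading s (env_in (aff_loop X s)).
Proof.
have := env_monoM X s env_mono1.
by rewrite addr0 mulr1 => /env_mono_deg.
Qed.

(* The composite gl_N^ -> U(gl_N^) -> U(gl_N^)_(comp,-), where U(gl_N^) is   *)
(* taken at c = the scalar c.                                                *)
Definition comp_in (x : L) : env_comp :=
  \sum_(r <- msupp x.1) comp_of (env_loop_deg x.1@_r r) + acst (c * x.2).

End Enveloping.

Section Evaluation.
Variables (K : fieldType) (N : nat) (eps1 eps2 c : K).
Local Notation U := (env N c).
Local Notation G := (env_grading N c).

(* E_(k,l)(s) in U *)
Definition uE (k l : nat) (s : int) : U := env_in c (aff_loop (mxE_mod K N k l) s).

Lemma uE_deg k l s : G s (uE k l s).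
Proof. exact: env_loop_deg. Qed.

(* The s-th terms of the infinite sums at the affine node, then at i > 0.    *)
Definition ev_term0p (s : nat) : U :=
  \sum_(1 <= k < N.+1) uE k 1%N (s%:Z + 1) * uE N k (- s%:Z).
Definition ev_term0m (s : nat) : U :=
  \sum_(1 <= k < N.+1) uE k N s%:Z * uE 1%N k (- s%:Z - 1).
Definition ev_termp (i s : nat) : U :=
  \sum_(1 <= k < i.+1) uE k i.+1 s%:Z * uE i k (- s%:Z)
  + \sum_(i.+1 <= k < N.+1) uE k i.+1 (s%:Z + 1) * uE i k (- s%:Z - 1).
Definition ev_termm (i s : nat) : U :=
  \sum_(1 <= k < i.+1) uE k i s%:Z * uE i.+1 k (- s%:Z)
  + \sum_(i.+1 <= k < N.+1) uE k i (s%:Z + 1) * uE i.+1 k (- s%:Z - 1).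

Lemma quad_filt n d p q (a b k : nat) (f h f' h' : nat -> nat) :
  d = p + q -> (n < k)%N -> q = - k%:Z ->
  filt G n d (\sum_(a <= j < b) uE (f j) (h j) p * uE (f' j) (h' j) q).
Proof.
move=> -> nk ->; apply: filt_sum => j _; apply: (filtM nk); last exact: uE_deg.
by rewrite subrK; apply: uE_deg.
Qed.

Lemma quad_deg d p q (a b : nat) (f h f' h' : nat -> nat) :
  d = p + q ->
  G d (\sum_(a <= j < b) uE (f j) (h j) p * uE (f' j) (h' j) q).
Proof.
by move=> ->; apply: gdeg_sum => j _; apply: gdegM; apply: uE_deg.
Qed.

Fact ev_term0p_deg s : G 1 (ev_term0p s).
Proof. by apply: (quad_deg _ _ id (fun=> _) (fun=> _) id); lia. Qed.
Fact ev_term0p_filt s : filt G s 1 (ev_term0p s.+1).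
Proof.
by apply: (@quad_filt _ _ _ _ _ _ s.+1 id (fun=> _) (fun=> _) id); lia.
Qed.
Fact ev_term0m_deg s : G (-1) (ev_term0m s).
Proof. by apply: (quad_deg _ _ id (fun=> _) (fun=> _) id); lia. Qed.
Fact ev_term0m_filt s : filt G s (-1) (ev_term0m s.+1).
Proof.
by apply: (@quad_filt _ _ _ _ _ _ s.+2 id (fun=> _) (fun=> _) id); lia.
Qed.
Fact ev_termp_deg i s : G 0 (ev_termp i s).
Proof.
by apply: gdegD; apply: (quad_deg _ _ id (fun=> _) (fun=> _) id); lia.
Qed.
Fact ev_termp_filt i s : filt G s 0 (ev_termp i s.+1).
Proof.
apply: filtD.
  by apply: (@quad_filt _ _ _ _ _ _ s.+1 id (fun=> _) (fun=> _) id); lia.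
by apply: (@quad_filt _ _ _ _ _ _ s.+2 id (fun=> _) (fun=> _) id); lia.
Qed.
Fact ev_termm_deg i s : G 0 (ev_termm i s).
Proof.
by apply: gdegD; apply: (quad_deg _ _ id (fun=> _) (fun=> _) id); lia.
Qed.
Fact ev_termm_filt i s : filt G s 0 (ev_termm i s.+1).
Proof.
apply: filtD.
  by apply: (@quad_filt _ _ _ _ _ _ s.+1 id (fun=> _) (fun=> _) id); lia.
by apply: (@quad_filt _ _ _ _ _ _ s.+2 id (fun=> _) (fun=> _) id); lia.
Qed.

Definition ev_sum (b : bool) (i : nat) : env_comp N c :=
  if i == 0%N then
    if b then comp_sum ev_term0p_deg ev_term0p_filt
    else comp_sum ev_term0m_deg ev_term0m_filt
  else
    if b then comp_sum (ev_termp_deg i) (ev_termp_filt i)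
    else comp_sum (ev_termm_deg i) (ev_termm_filt i).

Definition ev_x1 (b : bool) (i : nat) : env_comp N c :=
  (1 + (if i == 0%N then N else i)%:R * eps2) *s comp_in c (aff_x K N b i)
  + (eps1 + eps2) *s ev_sum b i.

Record evaluation_map (ev : yangian N eps1 eps2 -> env_comp N c) : Prop :=
  EvaluationMap {
  ev_hom : algebra_hom ev;
  ev_x0E : forall b (i : 'I_N), ev (y_x eps1 eps2 b i 0%N) =
    comp_in c (aff_x K N b i);
  ev_h0E : forall i : 'I_N, ev (y_h eps1 eps2 i 0%N) = comp_in c (aff_h K N i);
  ev_x1E : forall b (i : 'I_N), ev (y_x eps1 eps2 b i 1%N) = ev_x1 b i
}.

End Evaluation.

(* As gl_N^ generates U(gl_N^), this says that act restricts to the action   *)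
(* of U(gl_N^) given by rho.  No continuity of act is required.              *)
Definition extends_action (K : fieldType) (N : nat) (c : K) (M : lmodType K)
    (rho : affgl K N -> M -> M) (act : env_comp N c -> M -> M) : Prop :=
  forall x m, act (comp_in c x) m = rho x m.

(* Main.v *)
(* For a matrix index a put V_a = sum_(s >= 0) sum_k E_(k,a)(s+1) E_(a,k)(-s).  *)
(* As hbar != 0, the image of ev contains the infinite sum S of ev(x_(0,1)^+), *)
(* and [S, E_(1,N)] = V_N - V_1.  For a diagonal h = diag(h_1, ..., h_N) of    *)
(* trace 0 the commutator of h(m) with V_N - V_1 telescopes, off the diagonal, *)
(* to finite sums in U(sl_N^), while the central terms leave                   *)
(* m c (h_N E_(N,N) - h_1 E_(1,1))(m+1).  Taking h_1 = 0 and h_N = 1, which    *)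
(* needs N >= 3, the image contains E_(N,N)(n) for n != 1; in the same way     *)
(* x_(0,1)^- gives E_(1,1)(n) for n != -1.  Together with sl_N^, generated by  *)
(* the ev(x_(i,0)^+-), this is all of gl_N^, so a subspace stable under the    *)
(* Yangian is stable under gl_N^.                                              *)
Require Import Defs.
From mathcomp Require Import finmap monalg.
From mathcomp Require Import all_boot all_order all_algebra complex reals zify.

Set Implicit Arguments.
Unset Strict Implicit.
Unset Printing Implicit Defensive.

Import GRing.Theory Num.Theory.
Local Open Scope ring_scope.

(** As N and [eps2] are nonzero, hbar c = N eps2 forces hbar and c to be nonzero. The image [B] of
    [ev] is a subalgebra of the completion, and it is enough that it contains all of gl_N^
    ([comp_in_image]): a subspace stable under the Yangian is then stable under gl_N^, hence zero or
    everything.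

    The Chevalley generators yield every E_ij(s) with i != j and every E_ii(s) - E_jj(s)
    ([E_in_all], [diag_in]), so for each s a single E_aa(s) is missing. It comes from the infinite
    sum in ev(x_(0,1)^+) or ev(x_(0,1)^-). The bracket of that sum with E_ba leaves a difference of
    two diagonal series ([quad_comm]). A further bracket with h(m), h diagonal, turns their main
    parts into telescoping series with off-diagonal factors, whose values are finite sums of
    products in [B] ([lim_in_diag_quad]), while the central cocycle leaves a nonzero multiple of
    E_aa ([central_term_sum], [cartan_in]).

    The subalgebra [B] is not assumed closed under limits, so every infinite sum is handled through
    [lim_in], which demands that its value lie in [B]. *)

(** * Commutators and subalgebras *)

Lemma acst0 (K : fieldType) (A : assocAlgType K) : acst 0 = 0 :> A.
Proof. by apply: (addrI (acst 0)); rewrite -acstD !addr0. Qed.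

Lemma ascaleN1 (K : fieldType) (A : assocAlgType K) (x : A) : (-1) *s x = - x.
Proof.
apply: (addrI x); rewrite subrr -{1}[x]ascale1 /ascale -mulrDl -acstD subrr.
by rewrite acst0 mul0r.
Qed.

Lemma comm_brMl (A : pzRingType) (x y z : A) :
  comm_br (x * y) z = x * comm_br y z + comm_br x z * y.
Proof.
by rewrite /comm_br mulrBr mulrBl !mulrA addrA subrK.
Qed.

Lemma comm_brMr (A : pzRingType) (x y z : A) :
  comm_br x (y * z) = comm_br x y * z + y * comm_br x z.
Proof. by rewrite /comm_br mulrBr mulrBl !mulrA addrA subrK. Qed.

Lemma comm_brBr (A : pzRingType) (x y z : A) :
  comm_br x (y - z) = comm_br x y - comm_br x z.
Proof.
rewrite /comm_br mulrBr mulrBl !opprB [z * x - y * x]addrC addrACA.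
by rewrite [- (x * z) + _]addrC.
Qed.

Lemma comm_br_sumr (A : pzRingType) (I : Type) (r : seq I) (P : pred I)
    (x : A) (F : I -> A) :
  comm_br x (\sum_(i <- r | P i) F i) = \sum_(i <- r | P i) comm_br x (F i).
Proof. by rewrite /comm_br mulr_sumr mulr_suml sumrB. Qed.

Lemma comm_br_suml (A : pzRingType) (I : Type) (r : seq I) (P : pred I)
    (x : A) (F : I -> A) :
  comm_br (\sum_(i <- r | P i) F i) x = \sum_(i <- r | P i) comm_br (F i) x.
Proof. by rewrite /comm_br mulr_sumr mulr_suml sumrB. Qed.

Lemma ahom_comm (K : fieldType) (A A' : assocAlgType K) (f : A -> A') :
  algebra_hom f -> {morph f : x y / comm_br x y}.
Proof.
by case=> fD fZ _ fM x y; rewrite /comm_br fD -ascaleN1 fZ ascaleN1 !fM.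
Qed.

Record is_subalgebra (K : fieldType) (A : assocAlgType K) (B : A -> Prop) : Prop :=
  IsSubalgebra {
  subalg1 : B 1;
  subalgD : forall x y, B x -> B y -> B (x + y);
  subalgZ : forall (a : K) x, B x -> B (a *s x);
  subalgM : forall x y, B x -> B y -> B (x * y)
}.

Lemma image_subalgebra (K : fieldType) (A A' : assocAlgType K) (f : A -> A') :
  algebra_hom f -> is_subalgebra (fun x => exists y, f y = x).
Proof.
case=> fD fZ f1 fM; split; first by exists 1.
- by move=> _ _ [x <-] [y <-]; exists (x + y).
- by move=> a _ [x <-]; exists (a *s x).
by move=> _ _ [x <-] [y <-]; exists (x * y).
Qed.

(** * Limits of homogeneous sequences in the completion *)

Section Limits.
Variables (K : fieldType) (A : assocAlgType K) (G : grading A).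
Implicit Types (d e : int) (u v : nat -> A) (x y : completion G).

Lemma cmul_homl e a (ga : G e a) (w : cseq G) d n :
  cmul (hseq (const_ok ga)) w d n = a * w (d - e) n.
Proof.
rewrite [LHS]/= /cmul_val (@eq_big_supp _ _ [:: e]) ?zrange_uniq //; first last.
- by move=> f; rewrite inE; apply: contraNT => /negbTE fe; rewrite /= /hval fe mul0r.
- move=> f; rewrite mem_zrange /=; apply: contraNT => ef.
  rewrite /hval; have /negbTE -> : f != e by lia.
  by rewrite mul0r.
by rewrite big_seq1 /= /hval eqxx.
Qed.

Lemma cmul_homr e a (ga : G e a) (w : cseq G) d n :
  cmul w (hseq (const_ok ga)) d n = w (d - e) (n + `|e|)%N * a.
Proof.
rewrite [LHS]/= /cmul_val (@eq_big_supp _ _ [:: d - e]) ?zrange_uniq //; first last.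
- move=> f; rewrite inE; apply: contraNT => fd.
  rewrite /= /hval; have /negbTE -> : d - f != e by lia.
  by rewrite mulr0.
- move=> f h; rewrite mem_zrange.
  apply: (@cval_neq0 _ _ _ w f (n + `|(d - f)%R|)%N).
  by apply: contraNneq h => ->; rewrite mul0r.
have dE : d - (d - e) = e by lia.
by rewrite big_seq1 /= /hval dE eqxx.
Qed.

Lemma comp_of_eq d a b (ga : G d a) (gb : G d b) :
  a = b -> comp_of ga = comp_of gb.
Proof. by move=> ab; apply: cpi_eq => e n; rewrite /= ab. Qed.

Lemma comp_of0 d (g0 : G d 0) : comp_of g0 = 0.
Proof. by apply: cpi_eq => e n; rewrite /= /hval !if_same. Qed.

(** The sequence [u] need not be a coherent system of representatives, so partial sums may be
    rearranged freely. The vanishing of [w] outside degree [d] makes the limit unique. *)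
Definition tends d u x : Prop :=
  exists w : cseq G,
  [/\ cpi w = x, forall e n, e != d -> w e n = 0
    & forall n, exists k, forall m, (k <= m)%N -> filt G n d (u m - w d n)].

Lemma tends_const d a (ga : G d a) : tends d (fun=> a) (comp_of ga).
Proof.
exists (hseq (const_ok ga)); split=> // [e n /negbTE ed|n].
  by rewrite /= /hval ed.
by exists 0 => m _; rewrite /= /hval eqxx subrr; apply: filt0.
Qed.

Lemma tends_sum d (t : nat -> A) (tG : forall s, G d (t s))
    (tI : forall s, filt G s d (t s.+1)) :
  tends d (fun n => \sum_(s < n) t s) (comp_sum tG tI).
Proof.
exists (hseq (partial_sum_ok tG tI)); split=> // [e n /negbTE ed|n].
  by rewrite /= /hval ed.
(* The representatives of [comp_sum] run over s <= n and the sums here over s < n, whence the shift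
   by one. *)
exists n.+1 => -[//|m]; rewrite ltnS => nm.
have := cval_le (hseq (partial_sum_ok tG tI)) d nm.
by rewrite /= /hval eqxx.
Qed.

Lemma tends_eq d u v x : tends d u x ->
  (forall n, exists k, forall m, (k <= m)%N -> filt G n d (v m - u m)) ->
  tends d v x.
Proof.
case=> w [wx w0 wu] uv; exists w; split=> // n.
have [k1 h1] := wu n; have [k2 h2] := uv n.
exists (maxn k1 k2) => m; rewrite geq_max => /andP[/h1 ? /h2 ?].
by rewrite -(subrK (u m) (v m)) -addrA; apply: filtD.
Qed.

Lemma tends_unique d u x y : tends d u x -> tends d u y -> x = y.
Proof.
case=> [w [<- w0 wu]] [w' [<- w0' wu']]; apply/cpiP => e n.
have [->|ed] := eqVneq e d; last by rewrite w0 // w0' // subrr; apply: filt0.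
have [k1 h1] := wu n; have [k2 h2] := wu' n.
have := filtB (h2 _ (leq_maxr k1 k2)) (h1 _ (leq_maxl k1 k2)).
by rewrite opprB addrC addrA subrK.
Qed.

Lemma tendsD d u v x y :
  tends d u x -> tends d v y -> tends d (fun n => u n + v n) (x + y).
Proof.
case=> [w [<- w0 wu]] [w' [<- w0' wu']]; exists (cadd w w'); split.
- by rewrite /GRing.add /= compaddE.
- by move=> e n ed; rewrite /= /cadd_val w0 // w0' // addr0.
move=> n; have [k1 h1] := wu n; have [k2 h2] := wu' n.
exists (maxn k1 k2) => m; rewrite geq_max => /andP[/h1 ? /h2 ?].
by rewrite /= /cadd_val opprD addrACA; apply: filtD.
Qed.

Lemma tendsMl d e a (ga : G e a) u x :
  tends d u x -> tends (e + d) (fun n => a * u n) (comp_of ga * x).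
Proof.
case=> [w [<- w0 wu]]; exists (cmul (hseq (const_ok ga)) w); split.
- by rewrite /GRing.mul /= compmulE.
- move=> f n fd; rewrite cmul_homl w0 ?mulr0 //.
  by apply: contraNneq fd => <-; rewrite addrC subrK.
move=> n; have [k h] := wu n; exists k => m /h h'.
by rewrite cmul_homl [X in w X]addrC addKr -mulrBr; apply: filtMl h'.
Qed.

Lemma tendsMr d e a (ga : G e a) u x :
  tends d u x -> tends (d + e) (fun n => u n * a) (x * comp_of ga).
Proof.
case=> [w [<- w0 wu]]; exists (cmul w (hseq (const_ok ga))); split.
- by rewrite /GRing.mul /= compmulE.
- move=> f n fd; rewrite cmul_homr w0 ?mul0r //.
  by apply: contraNneq fd => <-; rewrite subrK.
move=> n; have [k h] := wu (n + `|e|)%N; exists k => m /h h'.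
by rewrite cmul_homr addrK -mulrBl; apply: filtMM h' _ _ _.
Qed.

Lemma tendsZ d u x (a : K) :
  tends d u x -> tends d (fun n => a *s u n) (a *s x).
Proof. by move/(tendsMl (acst_deg G a)); rewrite add0r. Qed.

Variable B : completion G -> Prop.
Hypothesis subB : is_subalgebra B.

(** This is not membership in the closure of [B]: the limit itself has to belong to [B]. *)
Definition lim_in d u : Prop := exists2 x, B x & tends d u x.
(** Membership of the image of [a] in [B], phrased so that no proof of homogeneity occurs in the
    term, as it does in [comp_of]; this keeps rewriting of [a] and [d] possible. *)
Definition deg_in d a : Prop := lim_in d (fun=> a) /\ G d a.

Lemma deg_inP d a (ga : G d a) : B (comp_of ga) <-> deg_in d a.
Proof.
split=> [Ba|[[x Bx xa] _]]; last by rewrite (tends_unique (tends_const ga) xa).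
by split=> //; exists (comp_of ga) => //; apply: tends_const.
Qed.

Lemma lim_in_eq d u v : lim_in d u ->
  (forall n, exists k, forall m, (k <= m)%N -> filt G n d (v m - u m)) ->
  lim_in d v.
Proof. by case=> x Bx ux uv; exists x => //; apply: tends_eq ux uv. Qed.

Lemma eq_lim_in d u v : u =1 v -> lim_in d u -> lim_in d v.
Proof.
move=> uv /lim_in_eq; apply=> n; exists 0 => m _.
by rewrite uv subrr; apply: filt0.
Qed.

Lemma lim_inD d u v :
  lim_in d u -> lim_in d v -> lim_in d (fun n => u n + v n).
Proof.
case=> x Bx ux [y By vy]; exists (x + y); first exact: subalgD.
exact: tendsD.
Qed.

Lemma lim_inZ d u (a : K) : lim_in d u -> lim_in d (fun n => a *s u n).
Proof.
case=> x Bx ux; exists (a *s x); first exact: subalgZ.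
exact: tendsZ.
Qed.

Lemma lim_inN d u : lim_in d u -> lim_in d (fun n => - u n).
Proof. by move/(lim_inZ (-1)); apply: eq_lim_in => n; rewrite ascaleN1. Qed.

Lemma lim_inB d u v :
  lim_in d u -> lim_in d v -> lim_in d (fun n => u n - v n).
Proof. by move=> Bu /lim_inN; apply: lim_inD. Qed.

Lemma deg_in0 d : deg_in d 0.
Proof.
split; last exact: gdeg0.
exists 0.
  by have := subalgZ subB 0 (subalg1 subB); rewrite /ascale acst0 mul0r.
by have := tends_const (gdeg0 G d); rewrite comp_of0.
Qed.

Lemma lim_in_sum d (I : Type) (r : seq I) (P : pred I) (F : I -> nat -> A) :
  (forall i, P i -> lim_in d (F i)) ->
  lim_in d (fun n => \sum_(i <- r | P i) F i n).
Proof.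
move=> hF; elim: r => [|i r IH].
  by apply: eq_lim_in (deg_in0 d).1 => n; rewrite big_nil.
case Pi: (P i); last by apply: eq_lim_in IH => n; rewrite big_cons Pi.
by apply: eq_lim_in (lim_inD (hF i Pi) IH) => n; rewrite big_cons Pi.
Qed.

Lemma lim_in_comm d e u a :
  lim_in d u -> deg_in e a -> lim_in (d + e) (fun n => comm_br (u n) a).
Proof.
case=> x Bx ux ha; have ga := ha.2; have Ba := (deg_inP ga).2 ha.
apply: lim_inB.
  exists (x * comp_of ga); first exact: subalgM.
  exact: tendsMr.
exists (comp_of ga * x); first exact: subalgM.
by rewrite addrC; apply: tendsMl.
Qed.

Lemma lim_in_comm_l d e u a :
  deg_in e a -> lim_in d u -> lim_in (e + d) (fun n => comm_br a (u n)).
Proof.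
move=> ha hu; rewrite addrC; apply: eq_lim_in (lim_inN (lim_in_comm hu ha)) => n.
by rewrite /comm_br opprB.
Qed.

Lemma deg_inZD d (k : K) a b : deg_in d a -> deg_in d b -> deg_in d (k *s a + b).
Proof.
move=> [ha ga] [hb gb]; split; last by apply: gdegD => //; apply: gdegZ.
by apply: lim_inD => //; apply: lim_inZ.
Qed.

Lemma deg_inD d a b : deg_in d a -> deg_in d b -> deg_in d (a + b).
Proof. by move=> ha /(deg_inZD 1 ha); rewrite ascale1. Qed.

Lemma deg_inB d a b : deg_in d a -> deg_in d b -> deg_in d (a - b).
Proof. by move=> ha hb; rewrite addrC -ascaleN1; apply: deg_inZD. Qed.

Lemma deg_inM d e a b : deg_in d a -> deg_in e b -> deg_in (d + e) (a * b).
Proof.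
move=> ha hb; split; last exact: gdegM ha.2 hb.2.
case: hb => -[x Bx bx] _; exists (comp_of ha.2 * x); last exact: tendsMl.
by apply: subalgM => //; apply/deg_inP.
Qed.

Lemma deg_in_cst (k : K) : deg_in 0 (acst k).
Proof.
split; last exact: acst_deg.
exists (acst k); last exact: tends_const.
by have := subalgZ subB k (subalg1 subB); rewrite /ascale mulr1.
Qed.

(* The partial sums of F(s + m) - F(s) telescope to finitely many terms *)
(* near s = 0, up to tails F(n + j) that tend to 0.                     *)
Lemma lim_in_telescope d (F : int -> A) :
  (forall j, deg_in d (F j)) ->
  (forall n, exists k : nat, forall j : int, k%:Z <= j -> filt G n d (F j)) ->
  forall m : int, lim_in d (fun n => \sum_(s < n) (F (s%:Z + m) - F s%:Z)).
Proof.
move=> BF F0.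
(* A unit shift telescopes to F(p + m) - F(m), with limit - F(m). Adding such sums gives positive
   shifts, subtracting them negative ones. *)
have step m : lim_in d (fun n => \sum_(s < n) (F (s%:Z + (m + 1)) - F (s%:Z + m))).
  apply: lim_in_eq (lim_inN (BF m).1) _ => n.
  have [k hk] := F0 n; exists (k + `|m|)%N => p kp.
  suff -> : \sum_(s < p) (F (s%:Z + (m + 1)) - F (s%:Z + m)) = F (p%:Z + m) - F m.
    by rewrite opprK subrK; apply: hk; lia.
  elim: p {kp} => [|p IH]; first by rewrite big_ord0 add0r subrr.
  rewrite big_ord_recr /= IH addrC addrA subrK; congr (F _ - _); lia.
have pos m : lim_in d (fun n => \sum_(s < n) (F (s%:Z + m%:Z) - F s%:Z)).
  elim: m => [|m IH].
    by apply: eq_lim_in (deg_in0 d).1 => n; rewrite big1 // => s _; rewrite addr0 subrr.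
  apply: eq_lim_in (lim_inD (step m%:Z) IH) => n.
  rewrite -big_split; apply: eq_bigr => s _ /=.
  by rewrite addrA subrK; congr (F _ - _); lia.
case=> m; first exact: pos.
elim: m => [|m IH].
  apply: eq_lim_in (lim_inN (step (-1))) => n; rewrite -sumrN.
  by apply: eq_bigr => s _; rewrite opprB addNr addr0.
apply: eq_lim_in (lim_inB IH (step (Negz m.+1))) => n.
rewrite -sumrB; apply: eq_bigr => s _ /=.
have -> : Negz m.+1 + 1 = Negz m by lia.
by rewrite opprB addrC addrA subrK.
Qed.

End Limits.

(* e X s stands for X(s), at central charge c. *)
Record is_loop_map (K : fieldType) (N : nat) (A : assocAlgType K) (G : grading A)
    (c : K) (e : 'M[K]_N -> int -> A) : Prop := IsLoopMap {
  loop_mapZD : forall a X Y s, e (a *: X + Y) s = a *s e X s + e Y s;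
  loop_map_comm : forall X Y r s,
    comm_br (e X r) (e Y s) =
      e (X *m Y - Y *m X) (r + s)
      + acst (c * (if r + s == 0 then r%:~R * \tr (X *m Y) else 0));
  loop_map_deg : forall X s, G s (e X s)
}.

(** * Linearity of loop maps *)

Section LoopMap.
Variables (K : fieldType) (N : nat) (A : assocAlgType K) (G : grading A) (c : K).
Variable e : 'M[K]_N -> int -> A.
Hypothesis eP : is_loop_map G c e.
Implicit Types (X Y : 'M[K]_N) (s : int).

Lemma loop_map0 s : e 0 s = 0.
Proof.
have := (loop_mapZD eP) 1 0 0 s; rewrite scaler0 addr0 ascale1 => h.
by apply: (addrI (e 0 s)); rewrite addr0 -h.
Qed.

Lemma loop_mapZ (a : K) X s : e (a *: X) s = a *s e X s.
Proof. by rewrite -[a *: X]addr0 (loop_mapZD eP) loop_map0 addr0. Qed.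

Lemma loop_mapD X Y s : e (X + Y) s = e X s + e Y s.
Proof. by rewrite -[X]scale1r (loop_mapZD eP) loop_mapZ ascale1. Qed.

Lemma loop_mapB X Y s : e (X - Y) s = e X s - e Y s.
Proof. by rewrite loop_mapD -[- Y]scaleN1r loop_mapZ ascaleN1. Qed.

Lemma loop_mapMn X s (b : bool) : e (X *+ b) s = e X s *+ b.
Proof. by case: b; rewrite ?mulr1n // mulr0n loop_map0. Qed.

End LoopMap.

(** * The loop map of the enveloping algebra *)

Section Loops.
Variables (K : fieldType) (N : nat) (c : K).
Implicit Types (X Y : 'M[K]_N) (r s m : int).

Lemma aff_loop_linear (a : K) X Y s :
  aff_loop (a *: X + Y) s = a *: aff_loop X s + aff_loop Y s.
Proof.
congr (_, _); last by rewrite /= mulr0 addr0.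
apply/malgP => r; rewrite /= mcoeffD loop_scaleE !mcoeffU.
by case: eqP => _; rewrite ?mulr1n // !mulr0n scaler0 addr0.
Qed.

Definition uloop X s : env N c := env_in c (aff_loop X s).

Lemma uloopZD (a : K) X Y s : uloop (a *: X + Y) s = a *s uloop X s + uloop Y s.
Proof.
rewrite /uloop aff_loop_linear /env_in /pres_gen.
have [qD qZ _ _] := qpi_hom (@env_rel K N c).
by rewrite -qZ -qD; apply/qpi_rel/env_linear.
Qed.

Lemma uloop_comm X Y r s :
  comm_br (uloop X r) (uloop Y s) =
    uloop (X *m Y - Y *m X) (r + s)
    + acst (c * (if r + s == 0 then r%:~R * \tr (X *m Y) else 0)).
Proof.
have [qD qZ q1 qM] := qpi_hom (@env_rel K N c).
have -> : comm_br (uloop X r) (uloop Y s) =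
    env_in c (aff_br (aff_loop X r) (aff_loop Y s)).
  by rewrite /env_in /pres_gen (qpi_rel (env_br _ _ _)) (ahom_comm (qpi_hom _)).
rewrite aff_br_loop addrC; set k := (if _ then _ else _).
rewrite {1}/env_in /pres_gen (qpi_rel (env_linear _ _ _ _)) qD qZ addrC.
congr (_ + _); rewrite (qpi_rel (env_c _ _)).
rewrite -[acst c]mulr1 -/(ascale c 1) qZ q1 /ascale mulr1 -acstM.
by congr acst; rewrite mulrC.
Qed.

Lemma uloop_map : is_loop_map (env_grading N c) c uloop.
Proof.
split; [exact: uloopZD | exact: uloop_comm | by move=> X s; exact: env_loop_deg].
Qed.

Lemma comp_in_loop X s : comp_in c (aff_loop X s) = comp_of (env_loop_deg c X s).
Proof.
rewrite /comp_in /= mulr0 acst0 addr0 msuppU.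
have [->|_] := eqVneq X 0; last first.
  by rewrite big_seq_fset1; apply: comp_of_eq; rewrite mcoeffUU.
rewrite big_seq_fset0 -(comp_of0 (gdeg0 (env_grading N c) s)).
by apply/comp_of_eq/esym/(loop_map0 uloop_map).
Qed.

End Loops.

(** * Diagonal elements from the quadratic series *)

Section Cartan.
Variables (K : fieldType) (N : nat) (A : assocAlgType K) (G : grading A) (c : K).
Variable e : 'M[K]_N -> int -> A.
Hypothesis eP : is_loop_map G c e.
Implicit Types (a b i j k l : 'I_N) (p q r s m u : int) (h : 'rV[K]_N).

Local Notation uE i j s := (e (delta_mx i j) s).

(** The cocycle would need s = 0, but then its factor s kills it. *)
Lemma loop_comm0 (X Y : 'M[K]_N) s :
  comm_br (e X s) (e Y 0) = e (X *m Y - Y *m X) s.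
Proof.
rewrite (loop_map_comm eP) addr0; case: eqP => [->|_];
  by rewrite ?mul0r mulr0 acst0 addr0.
Qed.

Lemma delta_comm0 i j k l s :
  comm_br (uE i j s) (uE k l 0) = uE i l s *+ (j == k) - uE k j s *+ (l == i).
Proof. by rewrite loop_comm0 !mul_delta_mx_cond (loop_mapB eP) !(loop_mapMn eP). Qed.

(* With q = u - 1 - s and p = s + u, this is the s-th term of the infinite sum *)
(* in ev(x_(0,1)^+) for a = N, b = u = 1, in ev(x_(0,1)^-) for a = 1, b = N, u = 0. *)
Definition quad a b p q : A := \sum_k uE k b p * uE a k q.

(** The product E_bb(p) E_aa(q) arises twice, from k = b in the right factor and from k = a in the
    left one, with opposite signs. *)
Lemma quad_comm a b p q :
  comm_br (quad a b p q) (uE b a 0) = quad a a p q - quad b b p q.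
Proof.
rewrite comm_br_suml.
under eq_bigr => k _ do
  rewrite comm_brMl !delta_comm0 !eqxx !mulr1n mulrBr mulrBl.
rewrite big_split /= !sumrB.
have sumE (X : 'I_N -> A) i : \sum_k X k *+ (k == i) = X i.
  by rewrite (bigD1 i) //= eqxx big1 ?addr0 // => k /negbTE ->.
under eq_bigr => k _ do rewrite mulrnAr.
under [in X in _ + (_ - X)]eq_bigr => k _ do rewrite mulrnAl eq_sym.
by rewrite !sumE addrC addrA subrK.
Qed.

Lemma diag_delta_comm h i j m p :
  comm_br (e (diag_mx h) m) (uE i j p) =
    (h 0 i - h 0 j) *s uE i j (m + p)
    + acst (c * (if m + p == 0 then m%:~R * h 0 i else 0) *+ (i == j)).
Proof.
have hE : diag_mx h *m delta_mx i j = h 0 i *: delta_mx i j.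
  apply/matrixP => x y; rewrite mul_diag_mx !mxE.
  by case: eqP => [->|]; rewrite ?mulr0.
have Eh : delta_mx i j *m diag_mx h = h 0 j *: delta_mx i j.
  apply/matrixP => x y; rewrite mul_mx_diag !mxE mulrC.
  by case: (y =P j) => [->|]; rewrite ?andbF ?mulr0.
rewrite (loop_map_comm eP) hE Eh -scalerBl (loop_mapZ eP); congr (_ + acst _).
have trE : \tr (delta_mx i j : 'M[K]_N) = (i == j)%:R.
  rewrite /mxtrace (bigD1 i) //= mxE eqxx big1 ?addr0 // => k /negbTE ki.
  by rewrite mxE ki.
rewrite mxtraceZ trE; case: eqP => _; last by rewrite mulr0 mul0rn.
by rewrite !mulrA mulr_natr.
Qed.

(** The cocycle part of the bracket of h(m) with [quad a a p q]. Only k = a contributes, since the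
    trace of h E_ka vanishes for k != a. *)
Definition central_term h m a p q : A :=
  (c * (if m + p == 0 then m%:~R * h 0 a else 0)) *s uE a a q
  + (c * (if m + q == 0 then m%:~R * h 0 a else 0)) *s uE a a p.

(** E_ka and E_ak have opposite weights under h, so the bracket moves m from one factor to the other
    with a sign. The coefficient vanishes at k = a, which leaves only off-diagonal factors. *)
Lemma diag_quad_comm h a m p q :
  comm_br (e (diag_mx h) m) (quad a a p q) =
    \sum_k (h 0 k - h 0 a) *s (uE k a (p + m) * uE a k q
                               - uE k a p * uE a k (q + m))
    + central_term h m a p q.
Proof.
rewrite comm_br_sumr.
rewrite [X in _ + X](_ : _ = \sum_k central_term h m a p q *+ (k == a)); last first.
  rewrite (bigD1 a) //= eqxx big1 ?addr0 // => k /negbTE -> //.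
rewrite -big_split; apply: eq_bigr => k _ /=.
rewrite comm_brMr !diag_delta_comm [m + p]addrC [m + q]addrC mulrDl mulrDr.
rewrite addrACA; congr (_ + _).
  rewrite -ascaleAl -ascaleAr -[h 0 a - h 0 k]opprB.
  rewrite ascaleDr -[in RHS]ascaleN1 !ascaleA; congr (_ + _ *s _).
  by rewrite mulrN1.
rewrite [a == k]eq_sym; have [->|_] := eqVneq k a; last first.
  by rewrite !mulr0n !acst0 mul0r mulr0 addr0.
by rewrite !mulr1n /central_term /ascale -acstC [m + p]addrC [m + q]addrC.
Qed.

(** For s >= 0 the numbers s + u and u - 1 - s together run over each integer exactly once, so - m
    is met once. The other factor then has degree (2u - 1) + m, whichever side was met. *)
Lemma central_term_sum h a u m (n : nat) : (`|m| + `|u| < n)%N ->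
  \sum_(s < n) central_term h m a (s%:Z + u) (u - 1 - s%:Z) =
    (c * (m%:~R * h 0 a)) *s uE a a (u + u - 1 + m).
Proof.
move=> mn.
(* The index at which - m is met: among the s + u if m + u <= 0, among the u - 1 - s otherwise. *)
pose s0 := `|(if m + u <= 0 then - m - u else m + u - 1)%R|%N.
have s0n : (s0 < n)%N by rewrite /s0; case: ifP; lia.
rewrite (bigD1 (Ordinal s0n)) //= big1 ?addr0 /central_term; last first.
  move=> s ss0.
  have {}ss0 : (s : nat) != s0 by apply: contraNneq ss0 => ss0; apply/eqP/val_inj.
  have /negbTE -> : m + (s%:Z + u) != 0 by move: ss0; rewrite /s0; case: ifP; lia.
  have /negbTE -> : m + (u - 1 - s%:Z) != 0 by move: ss0; rewrite /s0; case: ifP; lia.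
  by rewrite mulr0 /ascale acst0 !mul0r addr0.
have z0 x : (c * 0) *s x = 0 :> A by rewrite mulr0 /ascale acst0 mul0r.
case: (boolP (m + u <= 0)) => mu.
  have s0E : s0%:Z = - m - u by rewrite /s0 mu; lia.
  have -> : m + (s0%:Z + u) == 0 by lia.
  have -> : u - 1 - s0%:Z = u + u - 1 + m by lia.
  (* Both conditions at once would give 2(m + u) = 1, so the first case is contradictory. *)
  case: eqP => [m0|_]; last by rewrite z0 addr0.
  have {m0} -> : m = 0 by lia.
  by rewrite mul0r !z0 addr0.
have s0E : s0%:Z = m + u - 1 by rewrite /s0 (negbTE mu); lia.
have /negbTE -> : m + (s0%:Z + u) != 0 by lia.
have -> : m + (u - 1 - s0%:Z) == 0 by lia.
by rewrite z0 add0r; congr (_ *s e _ _); lia.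
Qed.

Variable B : completion G -> Prop.
Hypothesis subB : is_subalgebra B.
Hypothesis B_off : forall i j s, i != j -> deg_in B s (uE i j s).
Hypothesis B_diag : forall i j s,
  deg_in B s (e (delta_mx i i - delta_mx j j) s).

Lemma lim_in_diag_quad h a u m :
  lim_in B (u + u - 1 + m) (fun n => \sum_(s < n)
    (comm_br (e (diag_mx h) m) (quad a a (s%:Z + u) (u - 1 - s%:Z))
     - central_term h m a (s%:Z + u) (u - 1 - s%:Z))).
Proof.
pose F k (j : int) : A := uE k a (j + u) * uE a k (u - 1 + m - j).
apply: (@eq_lim_in _ _ _ _ _ (fun n => \sum_k (h 0 k - h 0 a) *s
   \sum_(s < n) (F k (s%:Z + m) - F k s%:Z))).
  move=> n; under eq_bigr => k _ do rewrite /ascale mulr_sumr.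
  rewrite exchange_big; apply: eq_bigr => s _ /=.
  rewrite diag_quad_comm addrK; apply: eq_bigr => k _.
  by rewrite /ascale /F; do 3![congr (_ * _) || congr (_ - _)]; congr e; lia.
apply: lim_in_sum => // k _; have [->|ka] := eqVneq k a.
  apply: eq_lim_in (deg_in0 subB _).1 => n.
  by rewrite subrr /ascale acst0 mul0r.
apply: (lim_inZ subB); apply: (lim_in_telescope subB) => [j|n].
  have -> : u + u - 1 + m = (j + u) + (u - 1 + m - j) by lia.
  by apply: (deg_inM subB); apply: B_off => //; rewrite eq_sym.
(* The right factor of F(j) has degree - r with r = j - u + 1 - m, and this bound on j makes r >
   n. *)
exists (`|u| + `|m| + n + 1)%N => j jn.
have [r rE] : exists r : nat, r%:Z = j - u + 1 - m.
  by exists `|(j - u + 1 - m)%R|%N; lia.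
apply: (@filtM _ _ _ _ _ r); first by lia.
  have -> : u + u - 1 + m + r%:Z = j + u by lia.
  exact: (loop_map_deg eP).
have -> : - r%:Z = u - 1 + m - j by lia.
exact: (loop_map_deg eP).
Qed.

(** With h = E_aa - E_ll and l different from a and b, h has entry 1 at a and 0 at b. So the
    b-series has no central part, and the a-series contributes c m E_aa(2u - 1 + m) with an
    invertible coefficient. *)
Lemma cartan_in a b l u m : a != b -> a != l -> b != l ->
  c != 0 -> m%:~R != 0 :> K ->
  lim_in B (u + u - 1)
    (fun n => \sum_(s < n) quad a b (s%:Z + u) (u - 1 - s%:Z)) ->
  deg_in B (u + u - 1 + m) (uE a a (u + u - 1 + m)).
Proof.
move=> ab al bl c0 m0 BT.
pose h : 'rV[K]_N := delta_mx 0 a - delta_mx 0 l.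
have hD : diag_mx h = delta_mx a a - delta_mx l l.
  apply/matrixP => i j; rewrite !mxE /=.
  have [<-|ij] := eqVneq i j; first by rewrite !andbb mulr1n.
  have ne x : (i == x) && (j == x) = false.
    by apply/negP => /andP[/eqP ix /eqP jx]; rewrite ix jx eqxx in ij.
  by rewrite mulr0n !ne subrr.
have ha : h 0 a = 1 by rewrite !mxE !eqxx (negbTE al) subr0.
have hb : h 0 b = 0 by rewrite !mxE !eqxx eq_sym (negbTE ab) (negbTE bl) subr0.
split; last exact: (loop_map_deg eP).
have Dm := B_diag a l m; rewrite -hD in Dm.
have := lim_in_comm subB BT (B_off 0 _ : deg_in B 0 (uE b a 0)).
rewrite eq_sym ab addr0 => /(_ isT) /(lim_in_comm_l subB Dm).
rewrite addrC => BQ.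
have := lim_inD subB (lim_inB subB BQ (lim_in_diag_quad h a u m))
  (lim_in_diag_quad h b u m).
have cm0 : c * m%:~R != 0 by rewrite mulf_neq0.
move/(lim_inZ subB (c * m%:~R)^-1)/lim_in_eq; apply=> n.
exists (`|m| + `|u|).+1 => p /(central_term_sum h a) hp.
set x := (X in _ *s X).
suff -> : x = (c * m%:~R) *s uE a a (u + u - 1 + m).
  by rewrite ascaleA mulVf // ascale1 subrr; apply: filt0.
have -> : c * m%:~R = c * (m%:~R * h 0 a) by rewrite ha mulr1.
rewrite -hp /x comm_br_suml comm_br_sumr.
rewrite -sumrB -big_split; apply: eq_bigr => s _ /=.
rewrite quad_comm comm_brBr.
have -> : central_term h m b (s%:Z + u) (u - 1 - s%:Z) = 0.
  rewrite /central_term hb !mulr0 !if_same.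
  by rewrite mulr0 /ascale acst0 !mul0r addr0.
move: (comm_br _ (quad a a _ _)) (comm_br _ (quad b b _ _)) => X Y.
by rewrite subr0 opprB -addrA [_ + Y]addrC addrA subrK addrC subrK.
Qed.

End Cartan.

(** * Generation of the loop elements *)

Section Generation.
Variables (K : fieldType) (N : nat) (A : assocAlgType K) (G : grading A) (c : K).
Variable e : 'M[K]_N -> int -> A.
Hypothesis eP : is_loop_map G c e.
Hypothesis N_gt2 : (2 < N)%N.
Variable B : completion G -> Prop.
Hypothesis subB : is_subalgebra B.
Implicit Types (i j k l : 'I_N) (r s : int).

Local Notation in_B X s := (deg_in B s (e X s)).
Local Notation E_in i j s := (in_B (delta_mx i j) s).

(** The central element is a scalar here, and [B] contains the scalars, so the cocycle can be
    discarded. *)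
Lemma loop_in_comm X Y r s :
  in_B X r -> in_B Y s -> in_B (X *m Y - Y *m X) (r + s).
Proof.
move=> hX hY; have hXY := deg_inM subB hX hY.
have := deg_inM subB hY hX; rewrite addrC => hYX.
set k := c * (if r + s == 0 then r%:~R * \tr (X *m Y) else 0).
have -> : e (X *m Y - Y *m X) (r + s) = comm_br (e X r) (e Y s) - acst k.
  by rewrite (loop_map_comm eP) addrK.
apply: (deg_inB subB); first exact: (deg_inB subB).
rewrite /k; case: eqP => [->|_]; first exact: (deg_in_cst subB).
by rewrite mulr0 acst0; apply: (deg_in0 subB).
Qed.

Lemma E_in_mul i j k r s : i != k -> E_in i j r -> E_in j k s -> E_in i k (r + s).
Proof.
move=> ik hi /(loop_in_comm hi); rewrite !mul_delta_mx_cond eqxx mulr1n.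
by rewrite eq_sym (negbTE ik) mulr0n subr0.
Qed.

(** The third index serves as the middle one in E_ij = [E_ik, E_kj], and as the l of [cartan_in]. *)
Lemma third_index i j : exists2 k, k != i & k != j.
Proof.
case: (pickP [pred k | (k != i) && (k != j)]) => [k /andP[]|ij]; first by exists k.
have : (#|'I_N| <= #|pred2 i j|)%N.
  apply/subset_leq_card/subsetP => k _; have := ij k.
  by rewrite !inE /=; case: (k == i); case: (k == j).
by rewrite card_ord card2; case: (i != j); lia.
Qed.

(* The paper's index k in 1..N; in particular N becomes 0. *)
Definition ordmod (k : nat) : 'I_N := Ordinal (ltn_pmod k (ltn_trans (ltn0Sn 1) N_gt2)).

Lemma ordmod_neq (k l : nat) : (0 < k < l)%N -> (l <= N)%N -> ordmod k != ordmod l.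
Proof.
move=> /andP[k0 kl]; rewrite leq_eqVlt => /orP[/eqP lN|lN]; apply/eqP => /(congr1 val) /=.
  by rewrite lN modnn modn_small; lia.
by rewrite !modn_small; lia.
Qed.

Lemma ordmodE i : exists2 k, (0 < k <= N)%N & i = ordmod k.
Proof.
exists (if i == 0 :> nat then N else i).
  by case: eqP; have := ltn_ord i; lia.
by apply: val_inj => /=; case: eqP => [->|_]; rewrite ?modnn // modn_small.
Qed.

(** Brackets with constant matrix units on the right and on the left change the column and the row
    of a single entry. *)
Lemma E_in_spread i0 j0 s : i0 != j0 ->
  (forall i j, i != j -> E_in i j 0) -> E_in i0 j0 s ->
  forall i j, i != j -> E_in i j s.
Proof.
move=> ij0 E0 h0.
have row j : i0 != j -> E_in i0 j s.
  move=> ij; have [<- //|jj] := eqVneq j0 j.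
  by rewrite -[s]addr0; apply: E_in_mul (E0 _ _ jj).
have col i j : i0 != j -> i != j -> E_in i j s.
  move=> i0j ij; have [<-|ii] := eqVneq i0 i; first exact: row.
  rewrite -[s]add0r; apply: E_in_mul (row _ i0j) => //.
  by apply: E0; rewrite eq_sym.
(* For j = i0 the left bracket would start from a diagonal entry, so the path goes through a third
   index k. *)
move=> i j ij; have [ji|] := eqVneq i0 j; last by move=> ?; exact: col.
have [k ki kj] := third_index i j.
rewrite -[s]addr0; apply: (E_in_mul ij _ (E0 k j kj)).
by apply: col; rewrite ?ji eq_sym.
Qed.

Hypothesis chevalley : forall k : nat, (k < N)%N ->
  E_in (ordmod k) (ordmod k.+1) (k == 0%N)%:Z /\
  E_in (ordmod k.+1) (ordmod k) (- (k == 0%N)%:Z).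

Lemma E_in_all i j s : i != j -> E_in i j s.
Proof.
(* Constant entries by induction on the distance of the indices in 1..N, without passing through the
   affine node. *)
have step (d k : nat) : (0 < k)%N -> (k + d.+1 <= N)%N ->
    E_in (ordmod k) (ordmod (k + d.+1)) 0 /\ E_in (ordmod (k + d.+1)) (ordmod k) 0.
  move=> k0; elim: d => [|d IH] kd.
    by have := @chevalley k; rewrite addn1 eqn0Ngt k0; apply; lia.
  have [|u1 l1] := IH; first by lia.
  have := @chevalley (k + d.+1)%N.
  have -> : (k + d.+1 == 0)%N = false by lia.
  rewrite oppr0 -addnS => -[|u2 l2]; first by lia.
  have ne : ordmod k != ordmod (k + d.+2) by apply: ordmod_neq; lia.
  split; first by rewrite -[0]addr0; apply: E_in_mul ne u1 u2.
  by rewrite -[0]addr0; apply: E_in_mul l2 l1; rewrite eq_sym.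
have E0 i' j' : i' != j' -> E_in i' j' 0.
  have [k k0 ->] := ordmodE i'; have [l l0 ->] := ordmodE j'.
  case: (ltngtP k l) => [kl|lk|->]; last by rewrite eqxx.
    have [||h _] := step (l - k).-1 k; try lia.
    by have -> : l = (k + (l - k).-1.+1)%N by lia.
  have [||_ h] := step (k - l).-1 l; try lia.
  by have -> : k = (l + (k - l).-1.+1)%N by lia.
have ne01 : ordmod 0 != ordmod 1.
  by apply/eqP => /(congr1 val) /=; rewrite !modn_small; lia.
have [E1 EN1] : E_in (ordmod 0) (ordmod 1) 1 /\ E_in (ordmod 1) (ordmod 0) (- 1).
  by apply: (@chevalley 0%N); lia.
have {}E1 := E_in_spread ne01 E0 E1.
have {ne01}EN1 : forall i j, i != j -> E_in i j (- 1).
  by apply: E_in_spread EN1 => //; rewrite eq_sym.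
have shift r t i' j' : (forall i j, i != j -> E_in i j r) ->
    (forall i j, i != j -> E_in i j t) -> i' != j' -> E_in i' j' (r + t).
  move=> hr ht ij; have [k ki kj] := third_index i' j'.
  by apply: (E_in_mul ij (hr i' k _) (ht k j' kj)); rewrite eq_sym.
have pos (n : nat) : forall i j, i != j -> E_in i j n%:Z.
  elim: n => [|n IH] i' j'; first exact: E0.
  move=> ij; have -> : n.+1%:Z = n%:Z + 1 by lia.
  exact: shift IH E1 ij.
have neg (n : nat) : forall i j, i != j -> E_in i j (- n%:Z).
  elim: n => [|n IH] i' j'; first exact: E0.
  move=> ij; have -> : - n.+1%:Z = - n%:Z - 1 by lia.
  exact: shift IH EN1 ij.
by case: s => n; [apply: pos | rewrite NegzE; apply: neg].
Qed.

Lemma diag_in i j s : in_B (delta_mx i i - delta_mx j j) s.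
Proof.
have [->|ij] := eqVneq i j.
  by rewrite subrr (loop_map0 eP); apply: (deg_in0 subB).
have ji : j != i by rewrite eq_sym.
have := loop_in_comm (E_in_all s ij) (E_in_all 0 ji).
by rewrite !mul_delta_mx addr0.
Qed.

(** One diagonal entry per degree suffices. Here m = s - (2u - 1), so u = 1 gives E_NN(s) unless s =
    1 and u = 0 gives E_11(s) unless s = -1; the exceptions do not meet. *)
Lemma loop_in_all : c != 0 -> (forall m : int, m != 0 -> m%:~R != 0 :> K) ->
  (forall u : bool, lim_in B (if u then 1 else -1) (fun n => \sum_(s < n)
     quad e (ordmod (~~ u)) (ordmod u) (s%:Z + u%:Z) (u%:Z - 1 - s%:Z))) ->
  forall X s, in_B X s.
Proof.
move=> c0 char0 T X s.
have ne01 (u : bool) : ordmod (~~ u) != ordmod u.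
  by apply/eqP => /(congr1 val) /=; rewrite !modn_small; case: u; lia.
have cartan (u : bool) : s != u%:Z + u%:Z - 1 ->
    E_in (ordmod (~~ u)) (ordmod (~~ u)) s.
  move=> su; have [l l1 l2] := third_index (ordmod (~~ u)) (ordmod u).
  have -> : s = u%:Z + u%:Z - 1 + (s - (u%:Z + u%:Z - 1)) by rewrite addrC subrK.
  rewrite eq_sym in l1; rewrite eq_sym in l2.
  apply: (cartan_in eP subB _ _ (ne01 u) l1 l2 c0).
  - by move=> *; apply: E_in_all.
  - exact: diag_in.
  - by apply: char0; rewrite subr_eq0.
  by have := T u; case: u {su l1 l2}.
have [i Eii] : exists i, E_in i i s.
  have [s1|s1] := eqVneq s 1; last by exists (ordmod 0); apply: (cartan true).
  by exists (ordmod 1); apply: (cartan false); rewrite s1.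
have E_in' j k : E_in j k s.
  have [->|] := eqVneq j k; last exact: E_in_all.
  have := deg_inD subB Eii (diag_in k i s).
  by rewrite -(loop_mapD eP) addrC subrK.
rewrite (matrix_sum_delta X).
elim/big_ind: _ => [|Y Z|j _]; first by rewrite (loop_map0 eP); apply: (deg_in0 subB).
  by rewrite (loop_mapD eP); apply: (deg_inD subB).
elim/big_ind: _ => [|Y Z|k _]; first by rewrite (loop_map0 eP); apply: (deg_in0 subB).
  by rewrite (loop_mapD eP); apply: (deg_inD subB).
rewrite -[_ *: _]addr0 (loop_mapZD eP) (loop_map0 eP).
by apply: (deg_inZD subB) => //; apply: (deg_in0 subB).
Qed.

End Generation.

(** * The image of the evaluation map *)

Section EvaluationImage.
Variables (K : numFieldType) (N : nat) (eps1 eps2 c : K).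
Hypothesis N_gt2 : (2 < N)%N.
Local Notation ordm := (ordmod N_gt2).

Lemma mxE_modE k l : mxE_mod K N k l = delta_mx (ordm k) (ordm l).
Proof. by apply/matrixP => i j; rewrite !mxE. Qed.

Lemma ordmodN : ordm N = ordm 0.
Proof. by apply: val_inj; rewrite /= modnn mod0n. Qed.

Lemma aff_xE b k : aff_x K N b k =
  if b then aff_loop (delta_mx (ordm k) (ordm k.+1)) (k == 0%N)%:Z
  else aff_loop (delta_mx (ordm k.+1) (ordm k)) (- (k == 0%N)%:Z).
Proof.
rewrite /aff_x !mxE_modE ordmodN.
by case: eqP => [->|_]; rewrite ?oppr0.
Qed.

Lemma sum_mod (V : nmodType) (F : 'I_N -> V) :
  \sum_(1 <= k < N.+1) F (ordm k) = \sum_k F k.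
Proof.
have -> : \sum_k F k = \sum_(0 <= k < N) F (ordm k).
  rewrite big_mkord; apply: eq_bigr => k _; congr F.
  by apply: val_inj; rewrite /= modn_small.
rewrite big_nat_recr ?(ltn_trans _ N_gt2) //= ordmodN.
by rewrite [RHS]big_ltn ?(ltn_trans _ N_gt2) // addrC.
Qed.

Definition ev_terms (u : bool) : nat -> env N c :=
  if u then ev_term0p N c else ev_term0m N c.

Lemma ev_termsE u s : ev_terms u s =
  quad (uloop c) (ordm (~~ u)) (ordm u) (s%:Z + u%:Z) (u%:Z - 1 - s%:Z).
Proof.
rewrite /ev_terms /quad -sum_mod; case: u.
  rewrite /ev_term0p; apply: eq_bigr => k _.
  rewrite /uE !mxE_modE ordmodN /uloop subrr add0r //.
rewrite /ev_term0m; apply: eq_bigr => k _.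
rewrite /uE !mxE_modE ordmodN /uloop addr0.
by have -> : (false : nat)%:Z - 1 - s%:Z = - s%:Z - 1 by lia.
Qed.

Lemma ev_sum0_tends (u : bool) :
  tends (if u then 1 else -1) (fun n => \sum_(s < n) ev_terms u s)
    (ev_sum N c u 0).
Proof. by case: u; apply: tends_sum. Qed.

Hypotheses (hc : (eps1 + eps2) * c = N%:R * eps2) (eps2_neq0 : eps2 != 0).
Variable ev : yangian N eps1 eps2 -> env_comp N c.
Hypothesis evP : evaluation_map ev.

Lemma comp_in_image (x : affgl K N) : exists y, ev y = comp_in c x.
Proof.
have subB := image_subalgebra (ev_hom evP).
set B := (fun x => exists y, ev y = x) in subB.
have : (eps1 + eps2) * c != 0.
  by rewrite hc mulf_neq0 // pnatr_eq0; lia.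
rewrite mulf_eq0 negb_or => /andP[hbar0 c0].
have xB b (k : nat) (kN : (k < N)%N) : B (comp_in c (aff_x K N b k)).
  by exists (y_x eps1 eps2 b (Ordinal kN) 0%N); rewrite (ev_x0E evP).
have loopB : forall X s, deg_in B s (uloop c X s).
  apply: (loop_in_all (uloop_map N c) (N_gt2 := N_gt2) subB _ c0) => [k kN|m|u].
  - have := xB true k kN; have := xB false k kN.
    by rewrite !aff_xE !comp_in_loop => /deg_inP hf /deg_inP ht.
  - by rewrite intr_eq0.
  apply: (@eq_lim_in _ _ _ _ _ (fun n => \sum_(s < n) ev_terms u s)).
    by move=> n; apply: eq_bigr => s _; rewrite ev_termsE.
  exists (ev_sum N c u 0); last exact: ev_sum0_tends.
  have N_gt0 := ltn_trans (ltn0Sn 1) N_gt2.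
  have x1B : B (ev_x1 N eps1 eps2 c u 0).
    by exists (y_x eps1 eps2 u (Ordinal N_gt0) 1%N); rewrite (ev_x1E evP).
  (* Dividing by hbar isolates the infinite sum from [ev_x1], whose other summand is a multiple of a
     Chevalley generator. *)
  rewrite -[ev_sum _ _ _ _]ascale1 -(mulVf hbar0) -ascaleA; apply: (subalgZ subB).
  set k := 1 + N%:R * eps2.
  have -> : (eps1 + eps2) *s ev_sum N c u 0 =
      ev_x1 N eps1 eps2 c u 0 + (- k) *s comp_in c (aff_x K N u 0).
    by rewrite -[- k]mulN1r -ascaleA ascaleN1 /ev_x1 /= addrAC subrr add0r.
  apply: (subalgD subB) => //; apply: (subalgZ subB).
  exact: xB.
rewrite /comp_in.
apply: (subalgD subB).
  elim/big_rec: _ => [|r y _ By].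
    have := deg_in0 subB 0 => -[[z Bz z0] _].
    have := tends_unique z0 (tends_const (gdeg0 _ 0)).
    by rewrite comp_of0 => <-.
  apply: (subalgD subB) => //.
  by apply/(deg_inP B (env_loop_deg c _ _)); apply: loopB.
have := subalgZ subB (c * x.2) (subalg1 subB).
by rewrite /ascale mulr1.
Qed.

End EvaluationImage.

Theorem corollary4p18 (R : realType) (N : nat) (hN : (3 <= N)%N)
    (eps1 eps2 c : R[i])
    (hc : (eps1 + eps2) * c = N%:R * eps2) (heps2 : eps2 != 0)
    (ev : yangian N eps1 eps2 -> env_comp N c) (hev : evaluation_map ev)
    (M : lmodType R[i]) (rho : affgl R[i] N -> M -> M)
    (rho_module : lie_module rho) (rho_c : forall m, rho aff_c m = c *: m)
    (rho_irr : irreducible rho)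
    (act : env_comp N c -> M -> M) (act_module : algebra_module act)
    (act_ext : extends_action rho act) :
  irreducible (pullback ev act).
Proof.
case: rho_irr => M_neq0 rho_sub; split=> // W [W0 Wlin Wact].
apply: rho_sub; split=> // x m Wm; rewrite -act_ext.
have [y <-] := comp_in_image hN hc heps2 hev x.
exact: Wact.
Qed.
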